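(* For every $\varepsilon>0$ there exists $\delta_0(\varepsilon)>0$ such that the following holds for all $0<\delta<\delta_0(\varepsilon)$. Let $p_1,\ldots,p_n$ be a set of points in $[0,1]^2$ and, for each $j$, let $T_j$ be a $\delta$-tube through $p_j$. If $n\geq \delta^{-3/2-\varepsilon}$, then there exist $j\neq k$ with $p_j\in T_k$.
   Context: A $\delta$-tube is the $\delta$-neighborhood in $\mathbb{R}^2$ of a line (its central line). A tube $T$ is ''through'' a point $p$ if the central line of $T$ passes through $p$. *)

(* Defs.v *)
From HB Require Import structures.
From mathcomp Require Import all_boot all_order all_algebra.
From mathcomp Require Import all_classical all_reals all_analysis.

Set Implicit Arguments.
Unset Strict Implicit.
Unset Printing Implicit Defensive.

Import Order.TTheory GRing.Theory Num.Theory.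
Import numFieldNormedType.Exports.

Local Open Scope classical_set_scope.
Local Open Scope ring_scope.

(* The library norm on ['rV[R]_2] is the max norm, hence this definition. *)
Definition euclidean_dist (R : realType) (x y : 'rV[R]_2) : R :=
  Num.sqrt (\sum_(i < 2) (x 0 i - y 0 i) ^+ 2).

Definition is_line (R : realType) (L : set 'rV[R]_2) : Prop :=
  exists a v : 'rV[R]_2, v != 0 /\ L = range (fun t : R => a + t *: v).

Definition neighborhood (R : realType) (delta : R) (A : set 'rV[R]_2) :
    set 'rV[R]_2 :=
  [set x | exists2 y, A y & euclidean_dist x y < delta].

(* For [0 < delta] a tube has exactly one central line. *)
Definition central_line (R : realType) (delta : R) (T L : set 'rV[R]_2) : Prop :=
  is_line L /\ T = neighborhood delta L.

Definition is_tube (R : realType) (delta : R) (T : set 'rV[R]_2) : Prop :=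
  exists L, central_line delta T L.

Definition tube_through (R : realType) (delta : R) (T : set 'rV[R]_2)
    (p : 'rV[R]_2) : Prop :=
  exists2 L, central_line delta T L & L p.

Definition unit_square (R : realType) : set 'rV[R]_2 :=
  [set x | forall i : 'I_2, 0 <= x 0 i <= 1].

(* Main.v *)
(* Write delta ~ b^-m with m fixed and b large. A point together with the slope
   of its line is a flag; flags are rounded to integer triples (X, Y, S). The
   boxes (X within U, S within W, height above the line within U W) are affine
   images of one another, so the problem rescales separately in position and in
   slope. After pigeonholing, the number of flags in the box U = b^-i,
   W = b^-j around each flag is about b^F(i,j) with F Lipschitz and
   F(0,0) >= (3/2 + eps) m; if there is no incidence, F vanishes for i + j >= m.

   A high-low argument compares the normalized numbers of incidences at the
   scales r and r/b: they are comparable unless the number of incidences at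
   scale r is bounded in terms of the largest number of points in an r-ball and
   of lines in an r-tube. An initial estimate at scale b^-c inside the box
   (i,j) comes from forks: around a flag z, each point of the box (i+c, j) is
   incident at that scale to each line of the box (i, j+c), and a given pair
   arises from at most b^(F(i+c,j+c)+O(c)) flags z. Incidences survive down to
   scale delta as soon as
     F(i+x,j) + F(i,j+x) + 3x + 2 F(i+c,j+c) + O(1) <= 2 F(i+c,j) + 2 F(i,j+c)
   for all x >= c.

   Such i, j, c exist for every Lipschitz F of mean slope above 3/2. Tilt F by
   a linear function and start at its maximum. Call a point good if its forks
   gain almost nothing. If no choice of c works, a point that is not good can
   be jumped over along its diagonal without loss, so good points have positive
   density on diagonals, hence in some row. A set of positive density meets
   every block of a long interval at some scale; along an arithmetic
   progression of nearly good points the failing inequalities become second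
   differences of constant sign, whose sum exceeds the Lipschitz bound. *)

Require Import Defs.
From mathcomp Require Import all_boot all_order all_algebra.
From mathcomp Require Import zify ring lra.
From mathcomp Require Import boolp.

Set Implicit Arguments.
Unset Strict Implicit.
Unset Printing Implicit Defensive.

Import Order.TTheory GRing.Theory Num.Theory.

(** * Uniformization by pigeonholing *)

Definition ncard (T : finType) (r : rel T) (A : {set T}) (x : T) : nat :=
  #|[set y in A | r x y]|.

Lemma ncard_sub (T : finType) (r : rel T) (A B : {set T}) (x : T) :
  A \subset B -> ncard r A x <= ncard r B x.
Proof.
move=> /subsetP sAB; apply: subset_leq_card; apply/subsetP => y.
by rewrite !inE => /andP[/sAB-> ->].
Qed.

Lemma ncard_gt0 (T : finType) (r : rel T) (A : {set T}) (x : T) :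
  reflexive r -> x \in A -> 0 < ncard r A x.
Proof. by move=> rr xA; apply/card_gt0P; exists x; rewrite !inE xA rr. Qed.

Lemma pigeonhole_fiber (T U : finType) (f : T -> U) (A : {set T}) : A != set0 ->
  exists2 u, #|A| <= #|U| * #|[set x in A | f x == u]| & [set x in A | f x == u] != set0.
Proof.
case/set0Pn=> x0 x0A; pose S u := [set x in A | f x == u].
have [u _ uM] := @arg_maxnP _ (f x0) predT (fun u => #|S u|) isT.
have x0S : x0 \in S (f x0) by rewrite !inE x0A eqxx.
exists u; last by rewrite -card_gt0 (leq_trans _ (uM (f x0) isT)) // (cardsD1 x0) x0S.
rewrite [#|A|](_ : _ = \sum_u #|S u|).
  by rewrite -sum_nat_const; apply: leq_sum => v _; apply: uM.
rewrite -sum1_card (partition_big f predT) //=; apply: eq_bigr => v _.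
by rewrite -sum1_card; apply: eq_bigl => x; rewrite !inE.
Qed.

Lemma subset_of_size (T : finType) (A : {set T}) (n : nat) : (n <= #|A|)%N ->
  exists2 B : {set T}, B \subset A & #|B| = n.
Proof.
move=> nA; exists [set x in take n (enum A)].
  by apply/subsetP => x; rewrite inE => /mem_take; rewrite mem_enum.
by rewrite cardsE (card_uniqP _) ?take_uniq ?enum_uniq // size_takel // -cardE.
Qed.

(** Round every count down to a power of [b] and keep the most popular vector of exponents, of which
    there are at most [M.+1 ^ #|Z|]. The counts are still taken in [A], not in [Y], so one pass does
    not make [Y] uniform. *)
Lemma constant_level (T Z : finType) (r : Z -> rel T) (b M : nat) (A : {set T}) :
    1 < b -> (forall z, reflexive (r z)) -> A != set0 -> #|A| < b ^ M.+1 ->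
  exists (Y : {set T}) (v : Z -> nat), [/\ Y \subset A, Y != set0,
    #|A| <= M.+1 ^ #|Z| * #|Y| &
    forall x z, x \in Y -> b ^ v z <= ncard (r z) A x < b ^ (v z).+1].
Proof.
move=> b1 rr A0 AM.
have lev x z : trunc_log b (ncard (r z) A x) < M.+1.
  rewrite ltnS; apply: (@leq_trans (trunc_log b (b ^ M.+1).-1)).
    rewrite leq_trunc_log // -ltnS prednK ?expn_gt0 ?(ltnW b1) //.
    by apply: leq_ltn_trans AM; apply: subset_leq_card; apply/subsetP=> y; rewrite inE => /andP[].
  rewrite -ltnS -(ltn_exp2l _ _ b1); apply: leq_ltn_trans (trunc_logP b1 _) _.
    have : b ^ 1 <= b ^ M.+1 by rewrite leq_exp2l.
    by rewrite expn1; lia.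
  by rewrite prednK ?expn_gt0 ?(ltnW b1).
pose f x : {ffun Z -> 'I_M.+1} := [ffun z => Ordinal (lev x z)].
have [u hu u0] := pigeonhole_fiber f A0.
exists [set x in A | f x == u], (fun z => nat_of_ord (u z)); split=> //.
- by apply/subsetP=> x; rewrite inE => /andP[].
- by rewrite card_ffun card_ord in hu.
move=> x z; rewrite inE => /andP[xA /eqP<-]; rewrite ffunE /=.
by rewrite trunc_logP ?trunc_log_ltn // ncard_gt0.
Qed.

(* Induction on the sum of the caps v: if passing twice to the most popular level
   loses some cap, restart from the smaller set with smaller caps. *)
Lemma uniformization_cap (T Z : finType) (r : Z -> rel T) (b M s : nat) (A : {set T})
    (v : Z -> nat) :
    1 < b -> (forall z, reflexive (r z)) -> A != set0 -> #|A| < b ^ M.+1 ->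
    \sum_z v z <= s -> (forall x z, x \in A -> ncard (r z) A x < b ^ (v z).+1) ->
  exists (XA XB XC : {set T}) (F : Z -> nat),
    [/\ XA \subset A, XB \subset XA, XC \subset XB & XC != set0] /\
    [/\ #|A| <= (M.+1 ^ #|Z|) ^ (2 * s) * #|XA|,
        forall x z, x \in XA -> ncard (r z) XA x < b ^ (F z).+1,
        forall x z, x \in XB -> b ^ F z <= ncard (r z) XA x &
        forall x z, x \in XC -> b ^ F z <= ncard (r z) XB x].
Proof.
move=> b1 rr; elim: s A v => [|s IHs] A v A0 AM vs capA;
  have [Y1 [v1 [Y1A Y10 AY1 hv1]]] := constant_level b1 rr A0 AM;
  have Y1M : #|Y1| < b ^ M.+1 by [apply: leq_ltn_trans AM; apply: subset_leq_card];
  have [Y2 [v2 [Y2Y1 Y20 Y1Y2 hv2]]] := constant_level b1 rr Y10 Y1M.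
all: have [x2 x2Y2] := set0Pn _ Y20; have x2Y1 := subsetP Y2Y1 _ x2Y2;
     have x2A := subsetP Y1A _ x2Y1.
all: have v1v z : v1 z <= v z by
  [rewrite -ltnS -(ltn_exp2l _ _ b1); have /andP[h _] := hv1 x2 z x2Y1; exact: leq_ltn_trans h (capA _ _ x2A)].
all: have v2v1 z : v2 z <= v1 z by
  [rewrite -ltnS -(ltn_exp2l _ _ b1); have /andP[h _] := hv2 x2 z x2Y2;
   have /andP[_ h'] := hv1 x2 z x2Y1; apply: leq_ltn_trans h (leq_ltn_trans (ncard_sub _ _ Y1A) h')].
(* If no cap drops during two passes, [A], [Y1], [Y2] and [v] themselves serve. *)
all: have win : (forall z, v z <= v2 z) -> forall s', exists (XA XB XC : {set T}) (F : Z -> nat),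
    [/\ XA \subset A, XB \subset XA, XC \subset XB & XC != set0] /\
    [/\ #|A| <= (M.+1 ^ #|Z|) ^ (2 * s') * #|XA|,
        forall x z, x \in XA -> ncard (r z) XA x < b ^ (F z).+1,
        forall x z, x \in XB -> b ^ F z <= ncard (r z) XA x &
        forall x z, x \in XC -> b ^ F z <= ncard (r z) XB x]
  by [move=> vv2 s'; exists A, Y1, Y2, v; split=> //; split=> //;
    [ rewrite leq_pmull // !expn_gt0
    | move=> x z xY1; have /andP[h _] := hv1 x z xY1; apply: leq_trans h;
      rewrite leq_exp2l // (leq_trans (vv2 z))
    | move=> x z xY2; have /andP[h _] := hv2 x z xY2; apply: leq_trans h;
      rewrite leq_exp2l // ]].
  apply: win => z; have : v z <= \sum_z v z by rewrite (bigD1 z) //= leq_addr.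
  by move: vs; rewrite leqn0 => /eqP->; rewrite leqn0 => /eqP->.
have [/forallP/(_ _) vv2|] := boolP [forall z, v z <= v2 z]; first exact: win.
rewrite negb_forall => /existsP[z0 z0lt]; rewrite -ltnNge in z0lt.
have lt : \sum_z v2 z <= s.
  rewrite -ltnS (leq_trans _ vs) // (bigD1 z0) //= [ltnRHS](bigD1 z0) //=.
  by rewrite -addSn leq_add // leq_sum // => z _; apply: leq_trans (v1v z).
have Y2M : #|Y2| < b ^ M.+1 by apply: leq_ltn_trans Y1M; apply: subset_leq_card.
have [x z xY2|XA [XB [XC [F [[s1 s2 s3 s4] [h1 h2 h3 h4]]]]]] := IHs Y2 v2 Y20 Y2M lt.
  by have /andP[_] := hv2 x z xY2; apply: leq_ltn_trans; apply: ncard_sub.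
exists XA, XB, XC, F; split; split=> //.
  by rewrite (subset_trans s1) // (subset_trans Y2Y1).
(* Each restart costs two passes, hence the exponent [2 * s]. *)
apply: (leq_trans AY1); rewrite mulnS expnD -mulnn -!mulnA leq_mul //.
by apply: (leq_trans Y1Y2); rewrite leq_mul.
Qed.

(** The caps start at [M], so their sum is at most [g * M]. The loss [C] depends on [g] and [M] but
    not on [b], so a large base can absorb it. *)
Lemma uniformization (g M : nat) : exists2 C : nat, 0 < C &
  forall (T Z : finType) (r : Z -> rel T) (b : nat) (A : {set T}),
    1 < b -> #|Z| = g -> (forall z, reflexive (r z)) -> A != set0 -> #|A| < b ^ M.+1 ->
  exists (XA XB XC : {set T}) (F : Z -> nat),
    [/\ XA \subset A, XB \subset XA, XC \subset XB & XC != set0] /\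
    [/\ #|A| <= C * #|XA|,
        forall x z, x \in XA -> ncard (r z) XA x < b ^ (F z).+1,
        forall x z, x \in XB -> b ^ F z <= ncard (r z) XA x &
        forall x z, x \in XC -> b ^ F z <= ncard (r z) XB x].
Proof.
exists ((M.+1 ^ g) ^ (2 * (g * M))); first by rewrite !expn_gt0.
move=> T Z r b A b1 Zg rr A0 AM.
have := @uniformization_cap T Z r b M (g * M) A (fun=> M) b1 rr A0 AM.
rewrite Zg; apply; first by rewrite sum_nat_const Zg.
move=> x z xA; apply: leq_ltn_trans AM; apply: subset_leq_card.
by apply/subsetP=> y; rewrite inE => /andP[].
Qed.

Local Open Scope ring_scope.

(** * Selecting a scale for a Lipschitz function of two variables *)

Definition fork_sum (g : nat -> nat -> int) (x y t : nat) : int :=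
  g (x + t)%N y + g x (y + t)%N.

(** A fork of length [t] gains at most [t / 4]. The gap between this 1/4 and the slope 1 in
    [fork_win] is what later perturbations spend. *)
Definition fork_good (g : nat -> nat -> int) (k x y : nat) : Prop :=
  forall t : nat, (k <= t)%N -> 4 * fork_sum g x y t <= 8 * g x y + t%:Z.

Definition lipschitz2 (Lam : nat) (g : nat -> nat -> int) : Prop :=
  forall x y, `|g x.+1 y - g x y| <= Lam%:Z /\ `|g x y.+1 - g x y| <= Lam%:Z.

Lemma lipschitz2_shift (Lam : nat) (g : nat -> nat -> int) (x y s t : nat) :
  lipschitz2 Lam g -> `|g (x + s)%N (y + t)%N - g x y| <= (Lam * (s + t))%:Z.
Proof.
move=> lipg; elim: s => [|s IHs].
  rewrite addn0 add0n; elim: t => [|t IHt]; first by rewrite addn0; lia.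
  by have [_] := lipg x (y + t)%N; rewrite addnS mulnS; lia.
by have [+ _] := lipg (x + s)%N (y + t)%N; rewrite addnS addSn mulnS; lia.
Qed.

(** Write s for the fork sum. The upper and lower bounds on [g] confine the candidates for [c], so a
    last one exists. Its maximality gives s(t) <= s(c) + (t - c)/4 for t >= c, and badness gives
    s(c) > 2 g(x, y) + c/4. Inserted in the failing inequality, these yield 2 g(x + c, y + c) > s(c)
    + c > 2 g(x, y). *)
Lemma fork_jump (Lam k x y : nat) (g : nat -> nat -> int) :
    g 0 0 = 0 -> lipschitz2 Lam g -> (forall u v, g u v <= - (u + v)%:Z) ->
    (forall c, (k <= c <= Lam * (x + y))%N -> exists2 t, (c <= t)%N &
       t%:Z < fork_sum g x y t + 2 * g (x + c)%N (y + c)%N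
                - 2 * fork_sum g x y c) ->
  ~ fork_good g k x y ->
  exists2 c, (0 < c)%N && (k <= c)%N & g x y <= g (x + c)%N (y + c)%N.
Proof.
move=> g00 lipg gle nowin /existsNP[t0 /not_implyP[kt0 /negP]].
rewrite -ltNge => t0bad.
have gxy : - (Lam * (x + y))%:Z <= g x y.
  by have := lipschitz2_shift 0 0 x y lipg; rewrite !add0n g00; lia.
have sle t : fork_sum g x y t <= - (2 * (x + y + t))%:Z.
  by have := gle (x + t)%N y; have := gle x (y + t)%N; rewrite /fork_sum; lia.
pose P t := (t0 <= t)%N && (4 * fork_sum g x y t0 - t0%:Z <= 4 * fork_sum g x y t - t%:Z).
have exP : exists t, P t by exists t0; rewrite /P leqnn lexx.
have Pub t : P t -> (t <= Lam * (x + y))%N.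
  by case/andP=> t0t; have := sle t; lia.
(* c is the last t at which 4 s(t) - t is at least its value at t0. *)
case: (ex_maxnP exP Pub) => c Pc cmax.
have cub := Pub _ Pc.
have /andP[t0c vc] := Pc.
have [|t ct] := nowin c; first by lia.
have ht : 4 * fork_sum g x y t - t%:Z <= 4 * fork_sum g x y c - c%:Z.
  have [->|tc] := eqVneq t c; first exact: lexx.
  rewrite leNgt; apply/negP => h; have : P t by rewrite /P; lia.
  by move/cmax; lia.
move=> hwin; exists c; last by lia.
have [c0|//] := posnP c; last by rewrite (leq_trans kt0).
by move: vc (sle t0) (sle 0%N) t0bad hwin; rewrite /fork_sum c0 !addn0; lia.
Qed.

(** The tilted form of the inequality under which incidences at depth [c] persist at every depth
    [t]. *)
Definition fork_win (g : nat -> nat -> int) (x y c : nat) : Prop :=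
  forall t, (c <= t)%N ->
    fork_sum g x y t + 2 * g (x + c)%N (y + c)%N - 2 * fork_sum g x y c <= t%:Z.

Lemma fork_winPn g x y c : ~ fork_win g x y c -> exists2 t, (c <= t)%N &
   t%:Z < fork_sum g x y t + 2 * g (x + c)%N (y + c)%N - 2 * fork_sum g x y c.
Proof.
by move=> /existsNP[t /not_implyP[ct /negP]]; rewrite -ltNge => h; exists t.
Qed.

(** Walk up the diagonal from [(d, 0)]: a step from a good point lowers [g] by at most [2 * Lam],
    and a jump from a bad point loses nothing. Since [g] starts at or above [- Lam * d] and ends at
    or below [- 2 * r], the good points must account for the drop. *)
Lemma fork_good_diagonal (Lam k B d r : nat) (g : nat -> nat -> int) :
    g 0 0 = 0 -> lipschitz2 Lam g -> (forall u v, g u v <= - (u + v)%:Z) ->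
    (forall x y c, (k <= c)%N -> (x + y + 2 * c <= B)%N -> ~ fork_win g x y c) ->
    ((d + 2 * r) * (1 + 2 * Lam) <= B)%N ->
  (2 * r <= 2 * Lam * (\sum_(0 <= u < r) `[< fork_good g k (d + u) u >]) + Lam * d)%N.
Proof.
move=> g00 lipg gle nowin hB.
have key n : forall t, (t <= r)%N -> (r - t <= n)%N -> g (d + t)%N t <=
    (2 * Lam * (\sum_(t <= u < r) `[< fork_good g k (d + u) u >]))%:Z - (2 * r)%:Z.
  elim: n => [|n IHn] t tr.
    rewrite leqn0 subn_eq0 => rt; have -> : t = r by lia.
    by rewrite big_geq // muln0; have := gle (d + r)%N r; lia.
  move=> hn; have [rt|{}tr] := leqP r t.
    by rewrite big_geq // muln0; have := gle (d + t)%N t; lia.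
  have [tgood|tbad] := boolP `[< fork_good g k (d + t) t >].
    rewrite big_ltn // tgood.
    have := IHn t.+1; have [h1 _] := lipg (d + t)%N t.
    have [_ h2] := lipg (d + t).+1 t; rewrite addnS; lia.
  have [c /andP[c0 kc] hc] : exists2 c, (0 < c)%N && (k <= c)%N &
      g (d + t)%N t <= g (d + t + c)%N (t + c)%N.
    apply: (fork_jump (Lam := Lam) (k := k)) => //; last by move/asboolPn: tbad.
    move=> c /andP[kc hc]; apply: fork_winPn; apply: nowin => //; nia.
  apply: (le_trans hc); have [rtc|tcr] := leqP r (t + c).
    by have := gle (d + t + c)%N (t + c)%N; lia.
  rewrite (@big_cat_nat _ _ _ (t + c)) /=; try lia.
  by have := IHn (t + c)%N; rewrite addnA; lia.
have := key r 0%N isT; rewrite subn0 addn0 => /(_ (leqnn _)).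
by have := lipschitz2_shift 0 0 d 0 lipg; rewrite !add0n g00; lia.
Qed.

Lemma fork_win_progression (Lam c x y : nat) (g : nat -> nat -> int) :
    (0 < c)%N -> (0 < Lam)%N -> lipschitz2 Lam g ->
    (forall i, (i < 8 * Lam)%N ->
       forall t, (c <= t)%N -> 4 * fork_sum g (x + i * c) y t <= 8 * g (x + i * c)%N y + 2 * t%:Z) ->
  exists2 i, (i < 8 * Lam)%N & fork_win g (x + i * c) y c.
Proof.
move=> c0 Lam0 lipg good; apply: contrapT => nowin.
(* A failing fork at x, next to a nearly good one, makes h grow by more than
   c/4 from x to x + c, whereas |h| <= Lam c. *)
pose h u : int := g u (y + c)%N - g u y.
have hb u : `|h u| <= (Lam * c)%:Z.
  by have := lipschitz2_shift u y 0 c lipg; rewrite addn0 add0n.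
have step i : (i < 8 * Lam)%N -> c%:Z < 4 * (h (x + i.+1 * c)%N - h (x + i * c)%N).
  move=> ilt; have /fork_winPn[t ct ht] : ~ fork_win g (x + i * c) y c.
    by move=> w; apply: nowin; exists i.
  have := good i ilt t ct; move: ht.
  by rewrite /h /fork_sum mulSn (addnC c) addnA; lia.
have tele n : (n <= 8 * Lam)%N -> (n * c)%:Z <= 4 * (h (x + n * c)%N - h x).
  elim: n => [|n IHn] hn; first by rewrite mul0n addn0; lia.
  by have := IHn (ltnW hn); have := step n hn; lia.
(* The total growth over [8 * Lam] steps can be at most [2 * Lam * c]. The telescoped inequality is
   weak and only reaches equality, so the strict last step is added separately. *)
have := tele _ (leqnn _); have := step 0%N; have := tele (8 * Lam).-1.
have := step (8 * Lam).-1; rewrite prednK; last by lia.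
have := hb x; have := hb (x + 8 * Lam * c)%N; nia.
Qed.

(** Moving the base point by [e] changes the inequality by at most [16 * Lam * e <= t], which the
    doubled allowance covers. *)
Lemma fork_good_near (Lam k e x x' y t : nat) (g : nat -> nat -> int) :
    lipschitz2 Lam g -> fork_good g k x y -> (x <= x' + e)%N -> (x' <= x + e)%N ->
    (k <= t)%N -> (16 * Lam * e <= t)%N ->
  4 * fork_sum g x' y t <= 8 * g x' y + 2 * t%:Z.
Proof.
move=> lipg good h1 h2 kt et; have := good t kt; rewrite /fork_sum => hgood.
have near v : `|g x' v - g x v| <= (Lam * e)%:Z.
  have [le|/ltnW le] := leqP x x'.
    have := lipschitz2_shift x v (x' - x) 0 lipg.
    have : (Lam * (x' - x) <= Lam * e)%N by rewrite leq_mul //; lia.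
    by rewrite subnKC // !addn0; lia.
  have := lipschitz2_shift x' v (x - x') 0 lipg.
  have : (Lam * (x - x') <= Lam * e)%N by rewrite leq_mul //; lia.
  by rewrite subnKC // !addn0; lia.
have near' : `|g (x' + t)%N y - g (x + t)%N y| <= (Lam * e)%:Z.
  have [le|/ltnW le] := leqP x x'.
    have := lipschitz2_shift (x + t) y (x' - x) 0 lipg.
    have -> : (x + t + (x' - x) = x' + t)%N by lia.
    have : (Lam * (x' - x) <= Lam * e)%N by rewrite leq_mul //; lia.
    by rewrite !addn0; lia.
  have := lipschitz2_shift (x' + t) y (x - x') 0 lipg.
  have -> : (x' + t + (x - x') = x + t)%N by lia.
  have : (Lam * (x - x') <= Lam * e)%N by rewrite leq_mul //; lia.
  by rewrite !addn0; lia.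
by have := near y; have := near (y + t)%N; lia.
Qed.

Lemma sum_blocks (f : nat -> nat) (a e K : nat) :
  (\sum_(a <= x < a + K * e) f x =
   \sum_(0 <= i < K) \sum_(a + i * e <= x < a + i.+1 * e) f x)%N.
Proof.
elim: K => [|K IHK]; first by rewrite mul0n addn0 !big_geq.
by rewrite big_nat_recr //= -IHK -big_cat_nat //= ?mulSn; lia.
Qed.

(** A Cantor-type count: an interval splits into [K] blocks, one of which contains no good point, so
    at most [K.-1] blocks matter at each level. The value of [K] is [8 * Lam] progression steps
    times [16 * Lam] blocks per step. *)
Lemma fork_good_porous (Lam c0 B j : nat) (g : nat -> nat -> int) :
    (0 < c0)%N -> (0 < Lam)%N -> lipschitz2 Lam g ->
    (forall x y c, (c0 <= c)%N -> (x + y + 2 * c <= B)%N -> ~ fork_win g x y c) ->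
  let K := (128 * Lam ^ 2)%N in
  forall a y, (a + y + 33 * Lam * (c0 * K ^ j) <= B)%N ->
  (\sum_(a <= x < a + c0 * K ^ j) `[< fork_good g (16 * Lam * c0) x y >]
     <= c0 * K.-1 ^ j)%N.
Proof.
move=> c00 Lam0 lipg nowin K.
have K0 : (0 < K)%N by rewrite muln_gt0 expn_gt0 Lam0.
elim: j => [|j IHj] a y hB.
  rewrite !expn0 !muln1 [leqRHS](_ : _ = \sum_(a <= x < a + c0) 1)%N.
    by apply: leq_sum => x _; case: `[< _ >].
  by rewrite sum_nat_const_nat addKn muln1.
set e := (c0 * K ^ j)%N; have -> : (c0 * K ^ j.+1 = K * e)%N by rewrite /e expnS mulnCA.
have hB' : (a + y + 33 * Lam * (K * e) <= B)%N by move: hB; rewrite /e expnS; lia.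
have e0 : (0 < e)%N by rewrite muln_gt0 c00 expn_gt0 K0.
have c0e : (c0 <= e)%N by rewrite leq_pmulr // expn_gt0 K0.
rewrite sum_blocks.
pose G x := `[< fork_good g (16 * Lam * c0) x y >].
have blk i : (i < K)%N ->
    (\sum_(a + i * e <= x < a + i.+1 * e) G x <= c0 * K.-1 ^ j)%N.
  move=> iK; have -> : (a + i.+1 * e = a + i * e + e)%N by rewrite mulSnr addnA.
  apply: (IHj (a + i * e)%N y); rewrite -/e.
  apply: leq_trans hB'; have : (i.+1 * e <= K * e)%N by rewrite leq_mul2r iK orbT.
  have : (33 * Lam * (i.+1 * e) <= 33 * Lam * (K * e))%N by rewrite leq_mul2l leq_mul2r iK !orbT.
  have : (i * e <= 33 * Lam * (i * e))%N by rewrite leq_pmull //; lia.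
  by lia.
(* Were every block to contain a good point, a progression with the larger step
   16 Lam e would consist of nearly good points. *)
have [i0 [i0K i0E]] : exists i0, (i0 < K)%N /\
    (\sum_(a + i0 * e <= x < a + i0.+1 * e) G x = 0)%N.
  apply: contrapT => nex.
  have meet i : (i < K)%N -> exists x, [/\ (a + i * e <= x)%N, (x < a + i.+1 * e)%N &
      fork_good g (16 * Lam * c0) x y].
    move=> iK; apply: contrapT => nx; apply: nex; exists i; split=> //.
    rewrite big_nat_cond big1 // => x /andP[/andP[x1 x2] _].
    by rewrite /G; case: asboolP => // gx; case: nx; exists x.
  have c1 : (0 < 16 * Lam * e)%N by rewrite muln_gt0 e0 muln_gt0 Lam0.
  have [|i il] := @fork_win_progression Lam (16 * Lam * e) a y g c1 Lam0 lipg.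
    move=> i il t ht.
    have [] := meet (i * (16 * Lam))%N.
      rewrite /K expnS expn1.
      have : (i * (16 * Lam) < 8 * Lam * (16 * Lam))%N by rewrite ltn_pmul2r //; lia.
      by lia.
    move=> x [x1 x2 gx]; apply: (fork_good_near (e := e) lipg gx).
    - by lia.
    - by lia.
    - by apply: leq_trans ht; rewrite leq_mul2l c0e orbT.
    - exact: ht.
  apply: nowin; first by rewrite (leq_trans c0e) // leq_pmull //; lia.
  apply: leq_trans hB'; rewrite /K expnS expn1.
  have : (i * (16 * Lam * e) <= 8 * Lam * (16 * Lam * e))%N by rewrite leq_mul //; lia.
  have : (Lam * e <= Lam * (Lam * e))%N by rewrite leq_pmull.
  have : (Lam * (Lam * e) <= Lam * (Lam * (Lam * e)))%N by rewrite leq_pmull.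
  by lia.
rewrite big_mkord (bigD1 (Ordinal i0K)) //= i0E add0n.
apply: (@leq_trans (\sum_(i < K | i != Ordinal i0K) (c0 * K.-1 ^ j))%N).
  by apply: leq_sum => i _; apply: blk.
rewrite sum_nat_const cardC1 card_ord expnS; lia.
Qed.

(** Bernoulli's inequality (1 + 1/q)^J >= 1 + J/q with denominators cleared. *)
Lemma expn_bernoulli (q J : nat) : ((q + J) * q ^ J <= q * q.+1 ^ J)%N.
Proof.
elim: J => [|J IHJ]; first by rewrite addn0 !expn0.
have : (q.+1 * ((q + J) * q ^ J) <= q.+1 * (q * q.+1 ^ J))%N by rewrite leq_mul.
by rewrite !expnS; nia.
Qed.

(** Otherwise good points have density at least [1 / (2 * Lam)] on each diagonal [d < N], while
    porosity bounds their density in each row by [(K.-1 / K) ^ J]. By Bernoulli,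
    [J = 2 * Lam * K.-1] makes the second smaller than the first, and double counting gives a
    contradiction. *)
Lemma fork_win_exists (Lam c0 : nat) : (0 < Lam)%N -> (0 < c0)%N ->
  exists B : nat, forall g : nat -> nat -> int,
    g 0 0 = 0 -> lipschitz2 Lam g -> (forall u v, g u v <= - (u + v)%:Z) ->
    exists x y c, [/\ (c0 <= c)%N, (x + y + 2 * c <= B)%N & fork_win g x y c].
Proof.
move=> Lam0 c00; pose K := (128 * Lam ^ 2)%N; pose J := (2 * Lam * K.-1)%N.
pose N := (c0 * K ^ J)%N; pose r := (Lam * N)%N.
exists ((N + 2 * r) * (1 + 2 * Lam) + (2 * r + 33 * Lam * N))%N.
move=> g g00 lipg gle; apply: contrapT => nowin.
set B := ((N + _) * _ + _)%N in nowin.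
have nowin' x y c : (c0 <= c)%N -> (x + y + 2 * c <= B)%N -> ~ fork_win g x y c.
  by move=> h1 h2 h3; apply: nowin; exists x, y, c.
have K1 : (1 < K)%N by rewrite /K expnS expn1; lia.
have N0 : (0 < N)%N by rewrite muln_gt0 c00 expn_gt0; lia.
pose G x y : nat := `[< fork_good g (16 * Lam * c0) x y >].
have diag d : (d < N)%N -> (N <= 2 * \sum_(0 <= u < r) G (d + u) u)%N.
  move=> dN; have : (2 * r <= 2 * Lam * (\sum_(0 <= u < r) G (d + u) u) + Lam * d)%N.
    apply: (@fork_good_diagonal Lam (16 * Lam * c0) B) => //.
    - move=> x y c hc; apply: nowin'; apply: leq_trans hc; rewrite leq_pmull //; lia.
    - by rewrite /B; apply: leq_trans (leq_addr _ _); rewrite leq_mul // leq_add2r (ltnW dN).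
  have : (Lam * d <= Lam * N)%N by rewrite leq_mul // ltnW.
  move: (\sum_(0 <= u < r) _)%N => s h1 h2.
  by rewrite -(leq_pmul2l Lam0); move: h2; rewrite /r; lia.
have row u : (u < r)%N -> (\sum_(0 <= d < N) G (d + u) u <= c0 * K.-1 ^ J)%N.
  move=> ur; have := @fork_good_porous Lam c0 B J g c00 Lam0 lipg nowin' u u.
  rewrite -/K -/N; have := big_addn 0 (u + N) u xpredT (G^~ u).
  rewrite add0n addKn => <-; apply.
  by rewrite /B -/N; apply: leq_trans (leq_addl _ _); rewrite leq_add2r; lia.
have h1 : (N * N <= 2 * \sum_(0 <= d < N) \sum_(0 <= u < r) G (d + u) u)%N.
  rewrite -{1}[N]subn0 -sum_nat_const_nat big_distrr /= big_nat [leqRHS]big_nat.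
  by apply: leq_sum => i iN; apply: diag.
have h2 : (\sum_(0 <= d < N) \sum_(0 <= u < r) G (d + u) u <= r * (c0 * K.-1 ^ J))%N.
  rewrite exchange_big /= -{2}[r]subn0 -sum_nat_const_nat big_nat [leqRHS]big_nat.
  by apply: leq_sum => u ur; apply: row.
have h3 : (N * N <= N * (2 * Lam * (c0 * K.-1 ^ J)))%N.
  apply: (leq_trans h1); apply: (leq_trans (leq_mul (leqnn 2) h2)).
  rewrite /r; move: (K.-1 ^ J)%N (N) => p n; lia.
move: h3; rewrite leq_pmul2l // {1}/N mulnCA leq_pmul2l // => h3.
have K1' : (0 < K.-1)%N by move: K1; case: (K) => [|[|]].
have := expn_bernoulli K.-1 J; rewrite (ltn_predK K1).
have -> : (K.-1 + J = K.-1 * (1 + 2 * Lam))%N by rewrite mulnDr muln1 mulnC.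
have : (0 < K.-1 ^ J)%N by rewrite expn_gt0 K1'.
rewrite -mulnA leq_pmul2l // mulnDl mul1n.
by move: h3; move: (K.-1 ^ J)%N (K ^ J)%N => p P; lia.
Qed.

Lemma scale_selection (E L C : nat) : (0 < E)%N -> (0 < L)%N ->
  exists m0 : nat, forall (m : nat) (F : nat -> nat -> nat), (m0 <= m)%N ->
    (forall i j, (F i.+1 j <= F i j <= F i.+1 j + L)%N) ->
    (forall i j, (F i j.+1 <= F i j <= F i j.+1 + L)%N) ->
    (forall i j, (m <= i + j)%N -> F i j = 0) ->
    ((3 * E + 3) * m <= 2 * E * F 0 0)%N ->
  exists i j c, (i + j + 2 * c <= m)%N /\
    forall x, (c <= x)%N -> (i + j + x <= m)%N ->
      (F (i + x) j + F i (j + x) + 3 * x + 2 * F (i + c) (j + c) + C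
         <= 2 * F (i + c) j + 2 * F i (j + c))%N.
Proof.
move=> E0 L0; pose Lam := (2 * E * L + 3 * E + 1)%N; pose c0 := (2 * E * C + 1)%N.
have [||B hB] := @fork_win_exists Lam c0; rewrite ?/Lam ?/c0 ?addn1 //.
exists (2 * E * L * B)%N => m F mm0 F1 F2 Fout F00.
pose H (p : 'I_m.+1 * 'I_m.+1) := (2 * E * F p.1 p.2 + (3 * E + 2) * (p.1 + p.2))%N.
pose P (p : 'I_m.+1 * 'I_m.+1) := (p.1 + p.2 <= m)%N.
have P0 : P (ord0, ord0) by [].
have [i [j [Pij Hmax]]] : exists i j, (i + j <= m)%N /\ forall i' j', (i' + j' <= m)%N ->
    (2 * E * F i' j' + (3 * E + 2) * (i' + j') <= 2 * E * F i j + (3 * E + 2) * (i + j))%N.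
  case: (arg_maxnP H P0) => -[i j] Pij Hmax; exists i, j; split=> // i' j' h.
  have i'm : (i' < m.+1)%N by lia.
  have j'm : (j' < m.+1)%N by lia.
  exact: (Hmax (Ordinal i'm, Ordinal j'm)).
have Fdecay d : (i + j + d <= m)%N -> (F i j <= F (i + d)%N j + L * d)%N.
  elim: d => [|d IHd] hd; first by rewrite addn0 leq_addr.
  have /andP[_ ] := F1 (i + d)%N j; rewrite addnS mulnS.
  by have := IHd (ltnW _); rewrite addnS in hd; move/(_ hd); lia.
(* The maximum is at distance at least [B] from the edge, where [F] vanishes: the excess [m] of the
   starting value must be made up at a rate of at most [2 * E * L] per unit. *)
have room : (B <= m - (i + j))%N.
  have := Fdecay (m - (i + j))%N; rewrite subnKC // leqnn => /(_ isT).
  rewrite (Fout (i + _)%N); last by lia.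
  rewrite add0n; have := Hmax 0%N 0%N isT; rewrite !addn0 muln0 addn0.
  move: (m - (i + j))%N (subnKC Pij) => q hq h1 h2.
  have h3 : (2 * E * F i j <= 2 * E * (L * q))%N by rewrite leq_mul.
  have h5 : ((3 * E + 2) * (i + j) <= (3 * E + 2) * m)%N by rewrite leq_mul.
  have h4 : (m <= 2 * E * L * q)%N by lia.
  have : (2 * E * L * B <= 2 * E * L * q)%N by exact: leq_trans h4.
  by rewrite leq_pmul2l // !muln_gt0 E0 L0.
pose G u v : int := (2 * E * F u v + (3 * E + 1) * (u + v))%:Z.
(* Lowering the tilt from [3 * E + 2] to [3 * E + 1] turns maximality into the decay [- (u + v)].
   The minimum enforces this decay beyond the triangle too, where maximality says nothing. *)
pose g u v : int := Order.min (G (i + u)%N (j + v)%N - G i j) (- (u + v)%:Z).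
have gin u v : (i + j + u + v <= m)%N -> g u v = G (i + u)%N (j + v)%N - G i j.
  move=> h; have := Hmax (i + u)%N (j + v)%N; rewrite /g /G; lia.
have [|||x [y [c [cc0 hc win]]]] := hB g.
- by rewrite /g !addn0 subrr.
- move=> u v; have /andP[a1 a2] := F1 (i + u)%N (j + v)%N.
  have /andP[a3 a4] := F2 (i + u)%N (j + v)%N; rewrite /g /G (addnS i) (addnS j).
  have scale p q : (p <= q)%N -> (2 * E * p <= 2 * E * q)%N by move=> ?; rewrite leq_mul.
  move: (scale _ _ a1) (scale _ _ a2) (scale _ _ a3) (scale _ _ a4).
  rewrite /Lam; move=> {Fdecay gin Hmax hB room} b1 b2 b3 b4; split; lia.
- by move=> u v; rewrite /g; lia.
exists (i + x)%N, (j + y)%N, c; split; first by lia.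
(* The linear terms cancel down to [(6 * E + 2) * t]. Against the [t] of [fork_win] this leaves
   [6 * E * t + t], and the last [t >= c0] pays for [2 * E * C]. *)
move=> t ct tm; have := win t ct; rewrite /fork_sum !gin; try lia.
rewrite -!addnA -(@leq_pmul2l (2 * E)) ?muln_gt0 // => h.
rewrite /c0 in cc0; move: h; rewrite /G.
move: (F _ _) (F _ _) (F _ _) (F _ _) (F _ _) (F i j) => f1 f2 f3 f4 f5 f6; lia.
Qed.

(** * The high-low estimate on the integer lattice *)

(** Lagrange's identity: the difference is half of a sum of squares. *)
Lemma sum_cauchy_schwarz (R : realDomainType) (I : finType) (f g : I -> R) :
  (\sum_i f i * g i) ^+ 2 <= (\sum_i f i ^+ 2) * (\sum_i g i ^+ 2).
Proof.
have h : 0 <= \sum_i \sum_j (f i * g j - f j * g i) ^+ 2.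
  by apply: sumr_ge0 => i _; apply: sumr_ge0 => j _; apply: sqr_ge0.
have e : \sum_i \sum_j (f i * g j - f j * g i) ^+ 2 =
    2 * ((\sum_i f i ^+ 2) * (\sum_i g i ^+ 2) - (\sum_i f i * g i) ^+ 2).
  have e1 : \sum_i \sum_j (f i ^+ 2 * g j ^+ 2) = (\sum_i f i ^+ 2) * (\sum_i g i ^+ 2).
    by rewrite mulr_suml; apply: eq_bigr => i _; rewrite mulr_sumr.
  have e2 : \sum_i \sum_j (f j ^+ 2 * g i ^+ 2) = (\sum_i f i ^+ 2) * (\sum_i g i ^+ 2).
    by rewrite exchange_big.
  have e3 : \sum_i \sum_j (f i * g i) * (f j * g j) = (\sum_i f i * g i) ^+ 2.
    by rewrite expr2 mulr_suml; apply: eq_bigr => i _; rewrite mulr_sumr.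
  transitivity (\sum_i \sum_j (f i ^+ 2 * g j ^+ 2) + \sum_i \sum_j (f j ^+ 2 * g i ^+ 2)
      - 2 * \sum_i \sum_j (f i * g i) * (f j * g j)); last by rewrite e1 e2 e3; ring.
  rewrite mulr_sumr -big_split -sumrB; apply: eq_bigr => i _.
  rewrite mulr_sumr -big_split -sumrB; apply: eq_bigr => j _ /=; ring.
by move: h; rewrite e pmulr_rge0 // subr_ge0.
Qed.

Lemma sum_int_window (f : int -> int) (n m : nat) (P : int) :
    0 <= P -> P + m%:Z <= n%:Z -> (forall v, ~~ (P <= v < P + m%:Z) -> f v = 0) ->
  \sum_(v < n) f v%:Z = \sum_(u < m) f (P + u%:Z).
Proof.
case: P => // p _ pmn f0.
rewrite -(big_mkord xpredT (fun v => f v%:Z)) -(big_mkord xpredT (fun u => f (p%:Z + u%:Z))).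
rewrite (@big_cat_nat _ _ _ p) //=; last by lia.
rewrite (@big_cat_nat _ _ _ (p + m) p) //=; [|by lia].
rewrite big_nat_cond big1 ?add0r; last by move=> i hi; apply: f0; lia.
rewrite [X in _ + X]big_nat_cond [X in _ + X]big1 ?addr0; last first.
  by move=> i hi; apply: f0; lia.
rewrite -{1}[p]add0n big_addn addKn; apply: eq_bigr => i _.
by rewrite addnC.
Qed.

Definition clampz (n : nat) (v : int) : int := Order.max 0 (Order.min n%:Z v).

Lemma count_int_window (n : nat) (P Q : int) : P <= Q ->
  \sum_(u < n) (nat_of_bool (P <= u%:Z < Q)%R)%:Z = clampz n Q - clampz n P.
Proof.
move=> PQ; elim: n => [|n IHn]; first by rewrite big_ord0 /clampz; lia.
rewrite big_ord_recr /= IHn /clampz.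
by case: (boolP (P <= n%:Z < Q)) => /=; lia.
Qed.

Lemma ceilz (s v : int) : 0 < s -> exists p : int, s * (p - 1) < v <= s * p.
Proof.
move=> s0; exists (- ((- v) %/ s)%Z).
have := divz_eq (- v) s; have := modz_ge0 (- v) (lt0r_neq0 s0).
have := ltz_pmod (- v) s0; move: (_ %/ _)%Z (_ %% _)%Z => q r h1 h2 h3.
by apply/andP; split; nia.
Qed.

(* A combination of two concentric strips of zero total weight, so that the
   correlation of two transversal strips cancels. *)
Definition hat (a d : nat) (v : int) : int :=
  d%:Z * (nat_of_bool (- a%:Z <= v < a%:Z)%R)%:Z
    - a%:Z * (nat_of_bool (- d%:Z <= v < d%:Z)%R)%:Z.

Definition hat_sum (a d R : nat) (s c : int) : int :=
  \sum_(u < 2 * R) hat a d (s * (u%:Z - R%:Z) + c).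

(* The lines of slope difference s and offset c cross near the boundary of the
   window |u| <= R, the only case in which cancellation fails. *)
Definition near_edge (w R : nat) (s c : int) : bool :=
  (`|s * R%:Z + c| <= w%:Z) || (`|c - s * R%:Z| <= w%:Z).

Lemma hat_abs (a d : nat) (v : int) : (a <= d)%N -> `|hat a d v| <= d%:Z.
Proof.
move=> ad; rewrite /hat.
by case: (boolP (- a%:Z <= v < a%:Z)); case: (boolP (- d%:Z <= v < d%:Z)) => /=; lia.
Qed.

Lemma hat_sum_trivial (a d R : nat) (s c : int) : (a <= d)%N ->
  `|hat_sum a d R s c| <= 2 * R%:Z * d%:Z.
Proof.
move=> ad; apply: (le_trans (ler_norm_sum _ _ _)).
apply: (@le_trans _ _ (\sum_(u < 2 * R) d%:Z)).
  by apply: ler_sum => u _; apply: hat_abs.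
by rewrite sumr_const card_ord -mulr_natl natz; lia.
Qed.

(** Multiplied by [s] to stay in the integers: the count is the length of the interval over [s], up
    to one. The lower bound needs a progression that starts before the interval and ends after
    it. *)
Lemma count_progression (lo hi s c : int) (n : nat) : 0 < s -> lo <= hi ->
  exists2 k : int, \sum_(u < n) (nat_of_bool (lo <= s * u%:Z + c < hi)%R)%:Z = k &
    [/\ 0 <= k, k <= n%:Z, s * k <= hi - lo + s &
        c <= lo -> hi <= c + s * n%:Z -> hi - lo - s <= s * k].
Proof.
move=> s0 lohi; have [P /andP[P1 P2]] := ceilz (lo - c) s0.
have [Q /andP[Q1 Q2]] := ceilz (hi - c) s0.
have PQ : P <= Q by rewrite -ltzD1 -(ltr_pM2l s0); lia.
exists (clampz n Q - clampz n P).
  rewrite -count_int_window //; apply: eq_bigr => u _; congr (_%:Z); congr nat_of_bool.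
  have [Pu|uP] := lerP P u%:Z; have [uQ|Qu] := ltrP u%:Z Q.
  - have : s * P <= s * u%:Z by rewrite ler_pM2l.
    have : s * u%:Z <= s * (Q - 1) by rewrite ler_pM2l; lia.
    by lia.
  - have : s * Q <= s * u%:Z by rewrite ler_pM2l.
    by lia.
  - have : s * u%:Z <= s * (P - 1) by rewrite ler_pM2l; lia.
    by lia.
  - have : s * u%:Z <= s * (P - 1) by rewrite ler_pM2l; lia.
    by lia.
have hk : 0 <= clampz n Q - clampz n P <= Q - P by rewrite /clampz; lia.
split; [by rewrite /clampz; lia|by rewrite /clampz; lia| |].
  apply: (@le_trans _ _ (s * (Q - P))); first by rewrite ler_pM2l //; lia.
  by lia.
move=> clo hin; have P0 : 0 <= P by rewrite -(ler_pM2l s0) mulr0; lia.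
have Qn : Q <= n%:Z by rewrite -ltzD1 -(ltr_pM2l s0); lia.
have -> : clampz n Q - clampz n P = Q - P by rewrite /clampz; lia.
by lia.
Qed.

(** The two strips are met about [2 * a / s] and [2 * d / s] times, so the weights [d] and [a]
    cancel the main terms when the line crosses both strips inside the window. When it passes
    neither, both counts vanish. A partial crossing happens only near the edge. *)
Lemma hat_sum_pos (a d R : nat) (s c : int) : (a <= d)%N -> 0 < s ->
  s * `|hat_sum a d R s c| <= 2 * a%:Z * d%:Z + s * d%:Z /\
  (~~ near_edge (2 * d) R s c -> `|hat_sum a d R s c| <= 2 * d%:Z).
Proof.
move=> ad s0; set c' := c - s * R%:Z.
have [|ka eka [ka0 kan ka1 ka2]] := @count_progression (- a%:Z) a%:Z s c' (2 * R) s0; first by lia.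
have [|kd ekd [kd0 kdn kd1 kd2]] := @count_progression (- d%:Z) d%:Z s c' (2 * R) s0; first by lia.
have -> : hat_sum a d R s c = d%:Z * ka - a%:Z * kd.
  rewrite -eka -ekd !mulr_sumr -sumrB; apply: eq_bigr => u _.
  by have -> : s * (u%:Z - R%:Z) + c = s * u%:Z + c' by rewrite /c'; ring.
have da1 : d%:Z * (s * ka) <= d%:Z * (a%:Z + a%:Z + s) by rewrite ler_wpM2l //; lia.
have ad1 : a%:Z * (s * kd) <= a%:Z * (d%:Z + d%:Z + s) by rewrite ler_wpM2l //; lia.
have as1 : a%:Z * s <= d%:Z * s by rewrite ler_wpM2r //; lia.
have p1 : 0 <= d%:Z * (s * ka) by rewrite !mulr_ge0 // ltW.
have p2 : 0 <= a%:Z * (s * kd) by rewrite !mulr_ge0 // ltW.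
split.
  rewrite -(gtr0_norm s0) -normrM (gtr0_norm s0) mulrBr.
  by rewrite ler_norml; apply/andP; split; lia.
rewrite /near_edge negb_or -!ltNge PoszM => /andP[e1 e2].
rewrite -(ler_pM2l s0) -{1}(gtr0_norm s0) -normrM mulrBr.
have sR : 0 <= s * R%:Z by rewrite mulr_ge0 // ltW.
have ec : c' + s * (2 * R)%N%:Z = s * R%:Z + c by rewrite /c' PoszM; ring.
have e2' : 2 * d%:Z < `|c'| by [].
have [cneg|cpos] := lerP c' (- (2 * d%:Z)).
  have [epos|eneg] := lerP (2 * d%:Z) (s * R%:Z + c).
    have da2 : d%:Z * (a%:Z + a%:Z - s) <= d%:Z * (s * ka).
      by rewrite ler_wpM2l //; have := ka2; rewrite ec; lia.
    have ad2 : a%:Z * (d%:Z + d%:Z - s) <= a%:Z * (s * kd).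
      by rewrite ler_wpM2l //; have := kd2; rewrite ec; lia.
    by rewrite ler_norml; apply/andP; split; lia.
  have zero lo : lo <= d%:Z -> \sum_(u < 2 * R) (nat_of_bool (- lo <= s * u%:Z + c' < lo)%R)%:Z = 0.
    move=> hlo; apply: big1 => u _.
    have : s * u%:Z <= s * (2 * R)%N%:Z by rewrite ler_pM2l // lez_nat ltnW.
    by case: (boolP (_ && _)) => //= /andP[]; lia.
  have ka_eq : ka = 0 by rewrite -eka zero //; lia.
  have kd_eq : kd = 0 by rewrite -ekd zero.
  by rewrite ka_eq kd_eq !mulr0 subrr normr0 mulr_ge0 // ltW.
have zero lo : lo <= d%:Z -> \sum_(u < 2 * R) (nat_of_bool (- lo <= s * u%:Z + c' < lo)%R)%:Z = 0.
  move=> hlo; apply: big1 => u _.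
  have : 0 <= s * u%:Z by rewrite mulr_ge0 // ltW.
  by case: (boolP (_ && _)) => //= /andP[]; lia.
have ka_eq : ka = 0 by rewrite -eka zero //; lia.
have kd_eq : kd = 0 by rewrite -ekd zero.
by rewrite ka_eq kd_eq !mulr0 subrr normr0 mulr_ge0 // ltW.
Qed.

(** The half-open window -R <= X < R is reflected by X -> -X - 1, hence the shift of [c] by [s]. *)
Lemma hat_sumN (a d R : nat) (s c : int) :
  hat_sum a d R s c = hat_sum a d R (- s) (c - s).
Proof.
rewrite /hat_sum (reindex_inj rev_ord_inj) /=; apply: eq_bigr => u _.
by congr hat; rewrite -subzn //; lia.
Qed.

Lemma hat_sum_bound (a d R : nat) (s c : int) : (a <= d)%N -> `|s| <= d%:Z ->
  `|s| * `|hat_sum a d R s c| <= 2 * a%:Z * d%:Z + `|s| * d%:Z /\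
  (~~ near_edge (3 * d) R s c -> `|hat_sum a d R s c| <= 2 * d%:Z).
Proof.
move=> ad sd; have [s0|s0|->] := ltrgt0P s.
- have [h1 h2] := hat_sum_pos R c ad s0; split=> // e; apply: h2; move: e.
  by rewrite /near_edge; lia.
- have ns0 : 0 < - s by rewrite oppr_gt0.
  have [h1 h2] := hat_sum_pos R (c - s) ad ns0; rewrite hat_sumN; split=> // e; apply: h2; move: e.
  by rewrite /near_edge mulNr; lia.
rewrite ?normr0 !mul0r; split; first by lia.
rewrite /near_edge mul0r add0r subr0 orbb -ltNge => hc.
rewrite /hat_sum big1 ?normr0; first by lia.
move=> u _; rewrite mul0r add0r /hat.
by case: (boolP (- a%:Z <= c < a%:Z)); case: (boolP (- d%:Z <= c < d%:Z)) => /=; lia.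
Qed.

Lemma hat_out (a d : nat) (v : int) : (a <= d)%N -> ~~ (- d%:Z <= v < d%:Z) -> hat a d v = 0.
Proof.
move=> ad hv; rewrite /hat (negbTE hv).
by case: (boolP (- a%:Z <= v < a%:Z)) => //=; lia.
Qed.

Lemma hat_abs_sum (a d : nat) : (a <= d)%N ->
  \sum_(e < 2 * d) `|hat a d (e%:Z - d%:Z)| <= 4 * a%:Z * d%:Z.
Proof.
move=> ad; pose h (w : nat) (e : nat) := (nat_of_bool (d%:Z - w%:Z <= e%:Z < d%:Z + w%:Z)%R)%:Z.
apply: (@le_trans _ _ (d%:Z * \sum_(e < 2 * d) h a e + a%:Z * \sum_(e < 2 * d) h d e)).
  rewrite !mulr_sumr -big_split /=; apply: ler_sum => e _; rewrite /hat /h.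
  have -> : (- a%:Z <= e%:Z - d%:Z < a%:Z) = (d%:Z - a%:Z <= e%:Z < d%:Z + a%:Z) by lia.
  have -> : (- d%:Z <= e%:Z - d%:Z < d%:Z) = (d%:Z - d%:Z <= e%:Z < d%:Z + d%:Z) by lia.
  by case: (_ && _); case: (_ && _) => /=; lia.
rewrite /h !count_int_window; try lia.
have -> : clampz (2 * d) (d%:Z + a%:Z) - clampz (2 * d) (d%:Z - a%:Z) = 2 * a%:Z.
  by rewrite /clampz; lia.
have -> : clampz (2 * d) (d%:Z + d%:Z) - clampz (2 * d) (d%:Z - d%:Z) = 2 * d%:Z.
  by rewrite /clampz; lia.
by lia.
Qed.

Definition hat_corr (a d R V : nat) (s1 t1 s2 t2 : int) : int :=
  \sum_(u < 2 * R) \sum_(v < 2 * V)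
    hat a d (v%:Z - V%:Z - (s1 * (u%:Z - R%:Z) + t1)) *
    hat a d (v%:Z - V%:Z - (s2 * (u%:Z - R%:Z) + t2)).

(** For fixed X the first hat confines Y to a window of length [2 * d] about its line. Relative to
    that line the second one has the slope and offset differences as parameters. *)
Lemma hat_corrE (a d R V : nat) (s1 t1 s2 t2 : int) : (a <= d)%N ->
    (forall u : nat, (u < 2 * R)%N -> `|s1 * (u%:Z - R%:Z) + t1| + d%:Z <= V%:Z) ->
  hat_corr a d R V s1 t1 s2 t2 =
  \sum_(e < 2 * d) hat a d (e%:Z - d%:Z) *
     hat_sum a d R (s1 - s2) (e%:Z - d%:Z + (t1 - t2)).
Proof.
move=> ad hV; under [RHS]eq_bigr do rewrite mulr_sumr.
rewrite exchange_big /=; apply: eq_bigr => u _.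
set c1 := s1 * _ + t1; set c2 := s2 * _ + t2.
have hc1 := hV u (ltn_ord u); rewrite -/c1 in hc1.
rewrite (@sum_int_window (fun v => hat a d (v - V%:Z - c1) * hat a d (v - V%:Z - c2))
  (2 * V) (2 * d) (V%:Z + c1 - d%:Z)); [|by lia|by lia|].
  by apply: eq_bigr => e _; congr (hat _ _ _ * hat _ _ _); rewrite /c1 /c2; ring.
by move=> v hv; rewrite hat_out ?mul0r //; lia.
Qed.

(** The first hat has absolute sum at most [4 * a * d], so each bound on [hat_sum] carries over.
    Offsets vary by [d] within the first strip, which widens the edge from [3 * d] to [4 * d]. *)
Lemma hat_corr_bound (a d R V : nat) (s1 t1 s2 t2 : int) : (a <= d)%N ->
    (forall u : nat, (u < 2 * R)%N -> `|s1 * (u%:Z - R%:Z) + t1| + d%:Z <= V%:Z) ->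
    `|s1 - s2| <= d%:Z ->
  let J := `|hat_corr a d R V s1 t1 s2 t2| in
  [/\ J <= 4 * a%:Z * d%:Z * (2 * R%:Z * d%:Z),
      `|s1 - s2| * J <= 4 * a%:Z * d%:Z * (2 * a%:Z * d%:Z + `|s1 - s2| * d%:Z) &
      ~~ near_edge (4 * d) R (s1 - s2) (t1 - t2) -> J <= 4 * a%:Z * d%:Z * (2 * d%:Z)].
Proof.
move=> ad hV sd J.
have key (q B : int) : 0 <= q -> 0 <= B ->
    (forall e : nat, (e < 2 * d)%N ->
       q * `|hat_sum a d R (s1 - s2) (e%:Z - d%:Z + (t1 - t2))| <= B) ->
    q * J <= 4 * a%:Z * d%:Z * B.
  move=> q0 B0 hB; rewrite /J hat_corrE // -{1}(ger0_norm q0) -normrM mulr_sumr.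
  apply: (le_trans (ler_norm_sum _ _ _)).
  apply: (@le_trans _ _ ((\sum_(e < 2 * d) `|hat a d (e%:Z - d%:Z)|) * B)).
    rewrite mulr_suml; apply: ler_sum => e _.
    by rewrite mulrCA !normrM (ger0_norm q0) ler_wpM2l ?normr_ge0 // hB.
  by rewrite ler_wpM2r // hat_abs_sum.
split.
- by rewrite -[leLHS]mul1r; apply: key => // e _; rewrite mul1r hat_sum_trivial.
- apply: key; rewrite ?normr_ge0 ?addr_ge0 ?mulr_ge0 ?normr_ge0 // => e _.
  by have [] := hat_sum_bound R (e%:Z - d%:Z + (t1 - t2)) ad sd.
move=> ne; rewrite -[leLHS]mul1r; apply: key; rewrite ?mulr_ge0 // => e he.
have [_] := hat_sum_bound R (e%:Z - d%:Z + (t1 - t2)) ad sd; rewrite mul1r; apply.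
move: ne; rewrite /near_edge; lia.
Qed.

(** The block from [b ^ p] to [b ^ p.+1] has fewer than [b ^ p.+1] terms of size at most [b ^- p],
    so it contributes at most [b]. The term at 0 counts as 1. *)
Lemma harmonic_sum_le (b p : nat) : (0 < b)%N ->
  \sum_(0 <= c < b ^ p) ((maxn 1 c)%:R^-1 : rat) <= (1 + p * b)%:R.
Proof.
move=> b0; elim: p => [|p IHp]; first by rewrite big_nat1 invr1.
have bp0 : (0 < b ^ p)%N by rewrite expn_gt0 b0.
have bb : (b ^ p <= b ^ p.+1)%N by rewrite leq_pexp2l.
rewrite (@big_cat_nat _ _ _ (b ^ p)) //= mulSn addnCA natrD addrC lerD //.
apply: (@le_trans _ _ (\sum_(b ^ p <= c < b ^ p.+1) ((b ^ p)%:R^-1 : rat))).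
  rewrite big_nat_cond [leRHS]big_nat_cond; apply: ler_sum => c /andP[/andP[c1 c2] _].
  by rewrite lef_pV2 ?posrE ?ltr0n ?ler_nat; lia.
rewrite sumr_const_nat -[leLHS]mulr_natr [leLHS]mulrC ler_pdivrMr ?ltr0n // -natrM ler_nat.
by rewrite expnS leq_subr.
Qed.

(** Four classes: which edge, and which sign of the slope difference. Two lines of one class have
    slopes within [e] and meet the edge within [8 * d] of each other. Over the length [R] the slopes
    add at most [d], so the offsets agree up to [9 * d]. *)
Lemma card_near_edge (T : finType) (A : {set T}) (sg tau : T -> int) (d R e M c : nat) (k : T) :
    (0 < e)%N -> d = (R * e)%N ->
    (forall k0, k0 \in A -> (#|[set k1 in A | ((`|sg k0 - sg k1| < e%:Z) &&
       (`|tau k0 - tau k1| <= 9 * d%:Z))%R]| <= M)%N) ->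
  (#|[set k1 in A | near_edge (4 * d) R (sg k - sg k1)%R (tau k - tau k1)%R &&
       (`|sg k - sg k1|%N %/ e == c)]| <= 4 * M)%N.
Proof.
move=> e0 dRe hM.
pose f k1 := (`|(sg k - sg k1) * R%:Z + (tau k - tau k1)| <= (4 * d)%N%:Z, 0 <= sg k - sg k1).
set S := [set _ in A | _].
rewrite -sum1_card (partition_big f predT) //=.
apply: (@leq_trans (\sum_(q : bool * bool) M)); last first.
  by rewrite sum_nat_const card_prod !card_bool.
apply: leq_sum => q _; rewrite sum1_card.
have [/existsP[k0 /andP[]]|] := boolP [exists k0, (k0 \in S) && (f k0 == q)]; last first.
  rewrite negb_exists => /forallP h; rewrite eq_card0 // => k1.
  exact: negbTE (h k1).
rewrite inE => /andP[k0A /andP[n0 c0]] /eqP f0.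
apply: leq_trans (hM k0 k0A); apply: subset_leq_card; apply/subsetP => k1 /andP[k1S /eqP f1].
move: k1S; rewrite !inE => /andP[k1A /andP[n1 c1]]; rewrite k1A /=.
have eR : (`|sg k0 - sg k1| < e%:Z).
  have hs : (0 <= sg k - sg k1) = (0 <= sg k - sg k0) by move: f0 f1; rewrite /f => <- [_].
  move: (divn_eq `|sg k - sg k0| e) (divn_eq `|sg k - sg k1| e).
  move: (ltn_pmod `|sg k - sg k0| e0) (ltn_pmod `|sg k - sg k1| e0).
  rewrite (eqP c0) (eqP c1); move: (_ %% _)%N (_ %% _)%N (c * e)%N hs => r0 r1 q0.
  by have [?|?] := lerP 0 (sg k - sg k1); have [?|?] := lerP 0 (sg k - sg k0) => // _; lia.
rewrite eR /=.
have dR : `|(sg k0 - sg k1) * R%:Z| <= d%:Z.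
  by rewrite normrM (ger0_norm (x := R%:Z)) // dRe PoszM mulrC ler_wpM2l // ltW.
have eq1 : (sg k - sg k1) * R%:Z = (sg k - sg k0) * R%:Z + (sg k0 - sg k1) * R%:Z by ring.
move: n0 n1 f0 f1 dR; rewrite /near_edge /f eq1 => n0 n1 <- [].
move: ((sg k - sg k0) * _) ((sg k0 - sg k1) * _) n0 n1 => z0 z1 n0 n1.
move: (tau k) (tau k0) (tau k1) n0 n1 => t t0 t1; clear => n0 n1 h1 h2.
by case/orP: n0 => n0; case/orP: n1 => n1; lia.
Qed.

Lemma sum_near_edge (T : finType) (A : {set T}) (sg tau : T -> int) (d R e M b p : nat) (k : T) :
    (0 < e)%N -> (0 < b)%N -> d = (R * e)%N ->
    (forall k0, k0 \in A -> (#|[set k1 in A | ((`|sg k0 - sg k1| < e%:Z) &&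
       (`|tau k0 - tau k1| <= 9 * d%:Z))%R]| <= M)%N) ->
    (forall k1, k1 \in A -> `|sg k - sg k1| < (b ^ p * e)%:Z) ->
  \sum_(k1 in A | near_edge (4 * d) R (sg k - sg k1) (tau k - tau k1))
     ((maxn 1 (`|sg k - sg k1| %/ e)%N)%:R^-1 : rat) <= (4 * M * (1 + p * b))%:R.
Proof.
move=> e0 b0 dRe hM hs; pose cell k1 := (`|sg k - sg k1| %/ e)%N.
pose P k1 := (k1 \in A) && near_edge (4 * d) R (sg k - sg k1) (tau k - tau k1).
have cellP k1 : P k1 -> (cell k1 < b ^ p)%N.
  by case/andP=> /hs h _; rewrite ltn_divLR //; lia.
have bp0 : (0 < b ^ p)%N by rewrite expn_gt0 b0.
pose ocell k1 := insubd (Ordinal bp0) (cell k1).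
have ocellE k1 : P k1 -> ocell k1 = cell k1 :> nat by move=> h; rewrite val_insubd cellP.
rewrite (partition_big ocell predT) //=.
apply: (@le_trans _ _ (\sum_(c < b ^ p) ((maxn 1 c)%:R^-1 * (4 * M)%:R : rat))).
  apply: ler_sum => c _.
  apply: (@le_trans _ _ (\sum_(k1 | P k1 && (ocell k1 == c)) ((maxn 1 c)%:R^-1 : rat))).
    apply: ler_sum => k1 /andP[Pk1 /eqP<-].
    by rewrite ocellE.
  rewrite sumr_const -[leLHS]mulr_natr ler_wpM2l ?invr_ge0 ?ler0n // ler_nat.
  apply: leq_trans (card_near_edge c k e0 dRe hM).
  apply: subset_leq_card; apply/subsetP => k1 /andP[Pk1 /eqP ec].
  have /andP[k1A nk1] := Pk1; rewrite inE k1A nk1 /=.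
  by rewrite -ec ocellE.
rewrite -mulr_suml [leLHS]mulrC [leRHS]natrM ler_wpM2l ?ler0n //.
by rewrite -(big_mkord xpredT (fun c => ((maxn 1 c)%:R^-1 : rat))) harmonic_sum_le.
Qed.

(** * Points thickened to boxes, and the high-low inequality *)

Definition box_ind (hX hV : nat) (x v X Y : int) : int :=
  (nat_of_bool (x <= X < x + hX%:Z)%R)%:Z * (nat_of_bool (v <= Y < v + hV%:Z)%R)%:Z.

Lemma box_ind_sum (hX hV R V : nat) (x v : int) :
    - R%:Z <= x -> x + hX%:Z <= R%:Z -> - V%:Z <= v -> v + hV%:Z <= V%:Z ->
  \sum_(q : 'I_(2 * R) * 'I_(2 * V)) box_ind hX hV x v (q.1%:Z - R%:Z) (q.2%:Z - V%:Z)
    = (hX * hV)%:Z.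
Proof.
have one (y : int) (h N : nat) : - N%:Z <= y -> y + h%:Z <= N%:Z ->
    \sum_(u < 2 * N) (nat_of_bool (y <= u%:Z - N%:Z < y + h%:Z)%R)%:Z = h%:Z.
  move=> h1 h2; transitivity (clampz (2 * N) (y + h%:Z + N%:Z) - clampz (2 * N) (y + N%:Z)).
    rewrite -count_int_window; last by lia.
    by apply: eq_bigr => u _; congr (nat_of_bool _)%:Z; lia.
  by rewrite /clampz; lia.
move=> h1 h2 h3 h4.
rewrite -(pair_bigA _ (fun u w => box_ind hX hV x v ((u : 'I_(2 * R))%:Z - R%:Z) ((w : 'I_(2 * V))%:Z - V%:Z))) /=.
rewrite /box_ind; under eq_bigr do rewrite -mulr_sumr (one v) //.
by rewrite -mulr_suml (one x).
Qed.

(** Inside the box the signed distance to the line varies by less than [a]. So only points within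
    [2 * a] can have a box meeting the inner strip, and a point within [d / 2] has its box inside
    the outer strip. *)
Lemma box_hat_le (a d hX hV : nat) (x v X Y s t : int) :
    (2 * a <= d)%N -> (0 < hX)%N -> `|s| * hX%:Z + hV%:Z <= a%:Z ->
  box_ind hX hV x v X Y * hat a d (Y - (s * X + t)) <=
  box_ind hX hV x v X Y * (d%:Z * (nat_of_bool (`|v - s * x - t| <= 2 * a%:Z)%R)%:Z
     - a%:Z * (nat_of_bool (2 * `|v - s * x - t| <= d%:Z)%R)%:Z).
Proof.
move=> ad hX0 hs; rewrite /box_ind.
case: (boolP (x <= X < x + hX%:Z)) => hX1; last by rewrite !mul0r.
case: (boolP (v <= Y < v + hV%:Z)) => hV1; last by rewrite mulr0 !mul0r.
rewrite mulr1 !mul1r /hat.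
have near : `|Y - (s * X + t) - (v - s * x - t)| < a%:Z.
  have -> : Y - (s * X + t) - (v - s * x - t) = (Y - v) - s * (X - x) by ring.
  have : `|s * (X - x)| <= `|s| * hX%:Z by rewrite normrM ler_wpM2l //; lia.
  by lia.
move: near; move: (Y - _) (v - _ - _) => y z near.
case: (boolP (- a%:Z <= y < a%:Z)) => h1; case: (boolP (- d%:Z <= y < d%:Z)) => h2;
 case: (boolP (`|z| <= 2 * a%:Z)) => h3; case: (boolP (2 * `|z| <= d%:Z)) => h4 /=; lia.
Qed.

Lemma box_ind_overlap (hX hV : nat) (x v x' v' X Y : int) :
  box_ind hX hV x v X Y * box_ind hX hV x' v' X Y <=
  box_ind hX hV x v X Y * (nat_of_bool ((`|x - x'| < hX%:Z) && (`|v - v'| < hV%:Z))%R)%:Z.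
Proof.
rewrite /box_ind.
case: (boolP (x <= X < x + hX%:Z)) => h1; last by rewrite !mul0r.
case: (boolP (v <= Y < v + hV%:Z)) => h2; last by rewrite mulr0 !mul0r.
case: (boolP (x' <= X < x' + hX%:Z)) => h3; last by rewrite mul0r mulr0 mulr_ge0.
case: (boolP (v' <= Y < v' + hV%:Z)) => h4; last by rewrite !mulr0 mulr_ge0.
have -> : (`|x - x'| < hX%:Z) by lia.
by have -> : (`|v - v'| < hV%:Z) by lia.
Qed.

Definition intercept (T : Type) (px pv sg : T -> int) (k : T) : int := pv k - sg k * px k.

(* The vertical distance from the point of j to the line of k. *)
Definition flag_dist (T : Type) (px pv sg : T -> int) (j k : T) : int :=
  `|pv j - pv k - sg k * (px j - px k)|.

Lemma corr_sum_bound (T : finType) (A : {set T}) (sg tau : T -> int)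
    (a d R V e M b p : nat) (k : T) :
    (a <= d)%N -> (0 < e)%N -> (0 < b)%N -> (0 < M)%N -> d = (R * e)%N -> (#|A| <= R)%N ->
    (forall k0, k0 \in A -> (#|[set k1 in A | ((`|sg k0 - sg k1| < e%:Z) &&
       (`|tau k0 - tau k1| <= 9 * d%:Z))%R]| <= M)%N) ->
    (forall k1, k1 \in A -> `|sg k - sg k1| < (b ^ p * e)%:Z) ->
    (forall k1, k1 \in A -> `|sg k - sg k1| <= d%:Z) ->
    (forall u : nat, (u < 2 * R)%N -> `|sg k * (u%:Z - R%:Z) + tau k| + d%:Z <= V%:Z) ->
  \sum_(k1 in A) hat_corr a d R V (sg k) (tau k) (sg k1) (tau k1)
    <= (4 * a * d * (d * R * M * (10 + 8 * (p * b))))%:Z.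
Proof.
move=> ad e0 b0 M0 dRe AR hM hs hsd hV.
(* A pair of lines crossing near the edge costs a weight 1/c, c being their slope
   difference in units of e; these add up to a harmonic sum. *)
pose J k1 := hat_corr a d R V (sg k) (tau k) (sg k1) (tau k1).
pose w k1 : rat := (maxn 1 (`|sg k - sg k1|%N %/ e))%:R^-1.
pose ne k1 := near_edge (4 * d) R (sg k - sg k1) (tau k - tau k1).
have Jle k1 : k1 \in A -> (J k1)%:~R <= (4 * a * d)%:R * ((2 * d)%:R + (2 * R * d)%:R * (if ne k1 then w k1 else 0)) :> rat.
  move=> k1A; have := hat_corr_bound (tau k1) ad hV (hsd k1 k1A).
  have JJ : J k1 <= `|J k1| by exact: ler_norm.
  move=> /= [h1 h2 h3]; rewrite -/(J k1) in h1 h2 h3.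
  case: ifP => [_|/negbT nk1]; last first.
    rewrite mulr0 addr0 -natrM -[leRHS]mulrz_nat ler_int natz.
    by have := h3 nk1; rewrite !PoszM; lia.
  rewrite /w; set c := (`|sg k - sg k1|%N %/ e)%N.
  have [c1|c0] := leqP 1 c; last first.
    rewrite invr1 mulr1 -natrD -natrM -[leRHS]mulrz_nat ler_int natz.
    apply: (le_trans JJ); apply: (le_trans h1).
    by rewrite -!PoszM lez_nat -!mulnA !leq_mul // mulnCA leq_addl.
  have ce : (c * e)%:Z <= `|sg k - sg k1| by rewrite -abszE lez_nat leq_trunc_div.
  have cJ : c%:Z * J k1 <= 4 * a%:Z * d%:Z * (2 * d%:Z * c%:Z + 2 * R%:Z * d%:Z).
    (* The slope difference may be replaced by its lower bound [c * e] only where its factor is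
       nonnegative; for small [J k1] the bound is immediate. *)
    have [small|big] := lerP `|J k1| (4 * a%:Z * d%:Z * d%:Z).
      apply: (@le_trans _ _ (c%:Z * (4 * a%:Z * d%:Z * d%:Z))).
        by rewrite ler_wpM2l // (le_trans JJ).
      have : 0 <= 4 * a%:Z * d%:Z * (d%:Z * c%:Z + 2 * R%:Z * d%:Z) by rewrite !mulr_ge0 // addr_ge0 // !mulr_ge0.
      by lia.
    have h4 : (c * e)%:Z * (`|J k1| - 4 * a%:Z * d%:Z * d%:Z) <= 4 * a%:Z * d%:Z * (2 * a%:Z * d%:Z).
      apply: (@le_trans _ _ (`|sg k - sg k1| * (`|J k1| - 4 * a%:Z * d%:Z * d%:Z))).
        by rewrite ler_wpM2r // subr_ge0 ltW.
      by move: h2; move: (`|sg k - _|) `|J k1| => s j; lia.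
    have h5 : c%:Z * (`|J k1| - 4 * a%:Z * d%:Z * d%:Z) <= 4 * a%:Z * d%:Z * (2 * a%:Z * R%:Z).
      have e0' : 0 < e%:Z by [].
      rewrite -(ler_pM2r e0'); move: h4; rewrite dRe !PoszM.
      by move: `|J k1| => j; lia.
    have h6 : 4 * a%:Z * d%:Z * (2 * a%:Z * R%:Z) <= 4 * a%:Z * d%:Z * (2 * d%:Z * R%:Z).
      by rewrite ler_wpM2l ?mulr_ge0 // ler_wpM2r // ler_wpM2l.
    have h7 : c%:Z * J k1 <= c%:Z * `|J k1| by rewrite ler_wpM2l.
    have h8 : 0 <= 4 * a%:Z * d%:Z * (d%:Z * c%:Z) by rewrite !mulr_ge0.
    by lia.
  have c0 : 0 < c%:R :> rat by rewrite ltr0n.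
  rewrite -(ler_pM2l c0).
  have -> : c%:R * ((4 * a * d)%:R * ((2 * d)%:R + (2 * R * d)%:R / c%:R)) =
      ((4 * a * d) * (2 * d * c + 2 * R * d))%N%:R :> rat.
    by rewrite !(natrD, natrM); field; rewrite gt_eqF.
  rewrite -[c%:R]mulrz_nat -intrM -[leRHS]mulrz_nat ler_int !natz.
  by rewrite !(PoszD, PoszM); lia.
rewrite -(@ler_int rat) rmorph_sum /=.
apply: (@le_trans _ _ (\sum_(k1 in A) ((4 * a * d)%:R *
    ((2 * d)%:R + (2 * R * d)%:R * (if ne k1 then w k1 else 0))))).
  by apply: ler_sum => k1 /Jle.
rewrite -mulr_sumr big_split /= -mulr_sumr -big_mkcondr /=.
have hS : \sum_(k1 in A | ne k1) w k1 <= (4 * M * (1 + p * b))%:R.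
  exact: (sum_near_edge e0 b0 dRe hM hs).
rewrite sumr_const -[(2 * d)%:R *+ _]mulr_natr.
apply: (@le_trans _ _ ((4 * a * d)%:R * ((2 * d)%:R * #|A|%:R + (2 * R * d)%:R * (4 * M * (1 + p * b))%:R))).
  by rewrite ler_wpM2l ?ler0n // lerD2l ler_wpM2l ?ler0n.
rewrite -!natrM -natrD -natrM -[leRHS]pmulrn ler_nat leq_mul //.
have h1 : (2 * d * #|A| <= 2 * d * (R * M))%N by rewrite leq_mul // (leq_trans AR) // leq_pmulr.
by apply: (leq_trans (leq_add h1 (leqnn _))); lia.
Qed.

Lemma sum_indicator (T : finType) (A : {set T}) (P : pred T) :
  \sum_(j in A) (nat_of_bool (P j))%:Z = #|[set j in A | P j]|%:Z.
Proof.
have -> : #|[set j in A | P j]| = (\sum_(j in A) nat_of_bool (P j))%N.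
  rewrite -sum1_card (eq_bigl (fun j => (j \in A) && P j)); last by move=> j; rewrite inE.
  by rewrite big_mkcondr; apply: eq_bigr => j _; case: (P j).
by elim/big_rec2: _ => // j m n _ ->; rewrite PoszD.
Qed.

(** Correlate [f], the sum of the boxes around the points, with [g], the sum of the hats around the
    lines. A pair within [2 * a] adds at most [d] per cell of the box and a pair within [d / 2]
    subtracts [a], so the correlation is very negative when the first alternative fails.
    Cauchy-Schwarz bounds it by square sums, which box overlaps ([MP]) and line correlations ([ML])
    control. *)
Lemma high_low (T : finType) (A : {set T}) (px pv sg : T -> int)
    (a d R e hX hV MP ML b p : nat) :
    (2 * a <= d)%N -> (0 < e)%N -> (0 < b)%N -> (0 < ML)%N -> (0 < hX)%N -> (0 < hV)%N ->
    (0 < a)%N -> d = (R * e)%N -> (#|A| <= R)%N ->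
    (forall j, j \in A -> - R%:Z <= px j /\ px j + hX%:Z <= R%:Z) ->
    (forall k, k \in A -> `|sg k| * hX%:Z + hV%:Z <= a%:Z) ->
    (forall j, j \in A -> (#|[set j1 in A | ((`|px j - px j1| < hX%:Z) &&
       (`|pv j - pv j1| < hV%:Z))%R]| <= MP)%N) ->
    (forall k, k \in A -> (#|[set k1 in A | ((`|sg k - sg k1| < e%:Z) &&
       (`|intercept px pv sg k - intercept px pv sg k1| <= 9 * d%:Z))%R]| <= ML)%N) ->
    (forall k k1, k \in A -> k1 \in A -> `|sg k - sg k1| < (b ^ p * e)%:Z) ->
    (forall k k1, k \in A -> k1 \in A -> `|sg k - sg k1| <= d%:Z) ->
  let N1 := #|[set q in setX A A | (flag_dist px pv sg q.1 q.2 <= 2 * a%:Z)%R]| in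
  let N2 := #|[set q in setX A A | (2 * flag_dist px pv sg q.1 q.2 <= d%:Z)%R]| in
  (a * N2 <= 2 * d * N1)%N \/
  (hX * hV * a * N2 ^ 2 <= 16 * #|A| ^ 2 * MP * ML * d ^ 2 * R * (10 + 8 * (p * b)))%N.
Proof.
move=> ad e0 b0 ML0 hX0 hV0 a0 dRe AR hpx hsg hMP hML hs hsd N1 N2.
have [le|lt] := leqP (a * N2) (2 * d * N1); [by left|right].
pose tau := intercept px pv sg.
(* The window is tall enough to contain every strip and every box; the estimates are uniform in
   [V]. *)
pose V := (\sum_(k in A) (`|sg k| * R + `|tau k|)%N + d + \sum_(j in A) (`|pv j|%N + hV))%N.
have hV1 k (u : nat) : k \in A -> (u < 2 * R)%N -> `|sg k * (u%:Z - R%:Z) + tau k| + d%:Z <= V%:Z.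
  move=> kA u2R; have : `|sg k * (u%:Z - R%:Z) + tau k| <= `|sg k| * R%:Z + `|tau k|.
    apply: (le_trans (ler_normD _ _)); rewrite lerD2r normrM ler_wpM2l //; lia.
  have : (`|sg k| * R + `|tau k|%N <= \sum_(k in A) (`|sg k| * R + `|tau k|)%N)%N.
    by rewrite (bigD1 k) //= leq_addr.
  by rewrite /V; lia.
have hV2 j : j \in A -> - V%:Z <= pv j /\ pv j + hV%:Z <= V%:Z.
  move=> jA; have : (`|pv j|%N + hV <= \sum_(j in A) (`|pv j|%N + hV))%N.
    by rewrite (bigD1 j) //= leq_addr.
  by rewrite /V; lia.
pose Q := ('I_(2 * R) * 'I_(2 * V))%type.
pose X (q : Q) : int := q.1%:Z - R%:Z; pose Y (q : Q) : int := q.2%:Z - V%:Z.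
pose bx j q := box_ind hX hV (px j) (pv j) (X q) (Y q).
pose ht k q := hat a d (Y q - (sg k * X q + tau k)).
have bxsum j : j \in A -> \sum_q bx j q = (hX * hV)%:Z.
  by move=> jA; have [? ?] := hpx j jA; have [? ?] := hV2 j jA; apply: box_ind_sum.
pose f q : int := \sum_(j in A) bx j q; pose g q : int := \sum_(k in A) ht k q.
have cards (c : T -> T -> bool) : \sum_(j in A) \sum_(k in A) (nat_of_bool (c j k))%:Z =
    #|[set q in setX A A | c q.1 q.2]|%:Z.
  rewrite pair_big /= -(sum_indicator (setX A A) (fun q => c q.1 q.2)).
  by apply: eq_bigl => -[j k]; rewrite in_setX.
have fg : \sum_q f q * g q <= (hX * hV)%:Z * (d%:Z * N1%:Z - a%:Z * N2%:Z).
  rewrite /N1 -(cards (fun j k => flag_dist px pv sg j k <= 2 * a%:Z)).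
  rewrite /N2 -(cards (fun j k => 2 * flag_dist px pv sg j k <= d%:Z)) !mulr_sumr -sumrB mulr_sumr.
  under eq_bigr do rewrite mulr_suml.
  rewrite exchange_big /=; apply: ler_sum => j jA.
  under eq_bigr do rewrite mulr_sumr.
  rewrite exchange_big /= !mulr_sumr -sumrB mulr_sumr; apply: ler_sum => k kA.
  rewrite -(bxsum j jA) mulr_suml; apply: ler_sum => q _.
  have := box_hat_le (px j) (pv j) (X q) (Y q) (tau k) ad hX0 (hsg k kA).
  have -> : pv j - sg k * px j - tau k = pv j - pv k - sg k * (px j - px k).
    by rewrite /tau /intercept; ring.
  exact.
have ff : \sum_q f q ^+ 2 <= (hX * hV * (#|A| * MP))%:Z.
  apply: (@le_trans _ _ (\sum_(j in A) \sum_(j1 in A) ((hX * hV)%:Z *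
      (nat_of_bool ((`|px j - px j1| < hX%:Z) && (`|pv j - pv j1| < hV%:Z))%R)%:Z))).
    under eq_bigr do rewrite expr2 mulr_suml.
    rewrite exchange_big /=; apply: ler_sum => j jA.
    under eq_bigr do rewrite mulr_sumr.
    rewrite exchange_big /=; apply: ler_sum => j1 j1A.
    rewrite -(bxsum j jA) mulr_suml; apply: ler_sum => q _; exact: box_ind_overlap.
  under eq_bigr do rewrite -mulr_sumr.
  rewrite -mulr_sumr [leRHS]PoszM ler_wpM2l //.
  apply: (@le_trans _ _ (\sum_(j in A) MP%:Z)); last by rewrite sumr_const -mulr_natl natz.
  apply: ler_sum => j jA; rewrite sum_indicator lez_nat; exact: hMP.
have gg : \sum_q g q ^+ 2 <= (#|A| * (4 * a * d * (d * R * ML * (10 + 8 * (p * b)))))%:Z.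
  under eq_bigr do rewrite expr2 mulr_suml.
  rewrite exchange_big /=.
  apply: (@le_trans _ _ (\sum_(k in A) (4 * a * d * (d * R * ML * (10 + 8 * (p * b))))%:Z)).
    apply: ler_sum => k kA; under eq_bigr do rewrite mulr_sumr.
    rewrite exchange_big /=.
    apply: le_trans (@corr_sum_bound T A sg tau a d R V e ML b p k _ e0 b0 ML0 dRe AR hML _ _ _).
    - apply: ler_sum => k1 k1A; rewrite /hat_corr pair_big /=; exact: lexx.
    - by lia.
    - by move=> k1; apply: hs.
    - by move=> k1; apply: hsd.
    - by move=> u; apply: hV1.
  by rewrite sumr_const -mulr_natl natz.
have cs := sum_cauchy_schwarz f g.
have beta0 : (0 < hX * hV * a)%N by rewrite !muln_gt0 hX0 hV0 a0.
rewrite -(leq_pmul2l beta0) -lez_nat.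
apply: (@le_trans _ _ (4 * ((\sum_q f q ^+ 2) * (\sum_q g q ^+ 2)))).
  apply: (@le_trans _ _ (4 * (\sum_q f q * g q) ^+ 2)); last by rewrite ler_pM2l.
  (* As [2 * d * N1 < a * N2], at least half of the term [a * N2] survives. *)
  have sneg : (hX * hV)%:Z * (a * N2)%:Z <= 2 * (- \sum_q f q * g q).
    have : (hX * hV)%:Z * (a * N2)%:Z <= (hX * hV)%:Z * (2 * (a%:Z * N2%:Z - d%:Z * N1%:Z)).
      by rewrite ler_wpM2l //; lia.
    by move: fg; move: (\sum_q _) ((hX * hV)%:Z) => s0 h0; lia.
  have := lerXn2r 2 (x := (hX * hV)%:Z * (a * N2)%:Z) (y := 2 * (- \sum_q f q * g q)).
  rewrite !nnegrE => /(_ _ _ sneg); rewrite mulr_ge0 // (le_trans _ sneg) ?mulr_ge0 //.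
  have -> : (2 * (- \sum_q f q * g q)) ^+ 2 = 4 * (\sum_q f q * g q) ^+ 2 by ring.
  move=> /(_ isT isT); apply: le_trans.
  by rewrite -!PoszM expr2 -PoszM lez_nat; move: (hX * hV)%N => h0; rewrite expnS expn1; lia.
have f0 : 0 <= \sum_q f q ^+ 2 by apply: sumr_ge0 => q _; apply: sqr_ge0.
have g0 : 0 <= \sum_q g q ^+ 2 by apply: sumr_ge0 => q _; apply: sqr_ge0.
apply: (@le_trans _ _ (4 * ((hX * hV * (#|A| * MP))%:Z *
   (#|A| * (4 * a * d * (d * R * ML * (10 + 8 * (p * b)))))%:Z))).
  by rewrite ler_pM2l // ler_pM.
rewrite -!PoszM lez_nat; move: (10 + _)%N (hX * hV)%N => h0 h1.
by rewrite !expnS !expn0; lia.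
Qed.

(** * Integer flags *)

(** The height [U * W] is the rise of a slope change [W] over a length [U]. Heights are measured
    from the line of [i], so the relation is not symmetric. *)
Definition flag_near (T : Type) (X Y S : T -> int) (U W : nat) (i j : T) : bool :=
  [&& `|X j - X i| <= U%:Z, `|S j - S i| <= W%:Z & flag_dist X Y S j i <= (U * W)%:Z].

Lemma flag_near_refl (T : Type) (X Y S : T -> int) (U W : nat) : reflexive (flag_near X Y S U W).
Proof. by move=> i; rewrite /flag_near /flag_dist !subrr mulr0 subr0 normr0. Qed.

Lemma flag_near_weak (T : Type) (X Y S : T -> int) (U W U' W' : nat) (i j : T) :
  (U <= U')%N -> (W <= W')%N -> flag_near X Y S U W i j -> flag_near X Y S U' W' i j.
Proof.
move=> hU hW /and3P[h1 h2 h3]; apply/and3P; split.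
- by rewrite (le_trans h1) ?lez_nat.
- by rewrite (le_trans h2) ?lez_nat.
by rewrite (le_trans h3) // lez_nat leq_mul.
Qed.

Lemma normz_mul_le (u v : int) (U V : nat) : `|u| <= U%:Z -> `|v| <= V%:Z -> `|u * v| <= (U * V)%:Z.
Proof. by move=> hu hv; rewrite normrM PoszM ler_pM. Qed.

(** The height is a sum of two heights and a slope difference times a position difference: three
    terms of size [U * W], against [b ^ 2 >= 4]. *)
Lemma flag_near_trans (T : Type) (X Y S : T -> int) (b U W : nat) (i j k : T) : (2 <= b)%N ->
  flag_near X Y S U W i j -> flag_near X Y S U W j k -> flag_near X Y S (b * U) (b * W) i k.
Proof.
move=> b2 /and3P[x1 s1 d1] /and3P[x2 s2 d2].
have hU : (2 * U <= b * U)%N by rewrite leq_mul.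
have hW : (2 * W <= b * W)%N by rewrite leq_mul.
have hUW : (4 * (U * W) <= b * U * (b * W))%N.
  have -> : (4 * (U * W) = 2 * U * (2 * W))%N by lia.
  by rewrite leq_mul.
apply/and3P; split; [by lia|by lia|].
rewrite /flag_dist in d1 d2 *.
have -> : Y k - Y i - S i * (X k - X i) = (Y k - Y j - S j * (X k - X j))
   + (Y j - Y i - S i * (X j - X i)) + (S j - S i) * (X k - X j) by ring.
have := normz_mul_le s1 x2; rewrite mulnC.
move: (Y k - _ - _) (Y j - _ - _) ((S j - _) * _) d1 d2 => y1 y2 y3 d1 d2; lia.
Qed.

(** Cut the range of [v] into at most [2 * K + 1] cells of length [q]; the elements of one cell are
    within [q] of any one of them. *)
Lemma card_le_cells (T : finType) (A : {set T}) (v : T -> int) (q K N : nat) : (0 < q)%N ->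
    (forall x, x \in A -> `|v x| <= (K * q)%:Z) ->
    (forall x, x \in A -> (#|[set y in A | (`|v y - v x| < q%:Z)%R]| <= N)%N) ->
  (#|A| <= (2 * K + 1) * N)%N.
Proof.
move=> q0 hv hN; pose cell x : nat := absz ((v x %/ q%:Z)%Z + K%:Z).
have q0' : 0 < q%:Z by [].
have cellE x : x \in A -> exists r : int, [/\ v x = (cell x)%:Z * q%:Z - (K * q)%:Z + r, 0 <= r,
    r < q%:Z & (cell x < 2 * K + 1)%N].
  move=> /hv hx; exists ((v x) %% q%:Z)%Z.
  have := divz_eq (v x) q; have := modz_ge0 (v x) (lt0r_neq0 q0').
  have := ltz_pmod (v x) q0'; rewrite /cell.
  move: (_ %/ _)%Z (_ %% _)%Z => p r h1 h2 h3.
  have p1 : - K%:Z <= p.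
    by rewrite -ltzD1 -(ltr_pM2r q0') mulrDl mulNr mul1r -PoszM; lia.
  have p2 : p <= K%:Z by rewrite -ltzD1 -(ltr_pM2r q0') mulrDl mul1r -PoszM; lia.
  split=> //; last by lia.
  have -> : (absz (p + K%:Z))%:Z = p + K%:Z by lia.
  by rewrite h3 mulrDl PoszM; ring.
pose ocell x : 'I_(2 * K + 1) := insubd (Ordinal (ltn_addl (2 * K) (ltn0Sn 0))) (cell x).
have oE x : x \in A -> ocell x = cell x :> nat.
  by move=> /cellE[r [_ _ _ h]]; rewrite val_insubd h.
rewrite -sum1_card (partition_big ocell predT) //=.
rewrite -[X in (X * N)%N]card_ord -sum_nat_const; apply: leq_sum => c _.
rewrite sum1_card.
have [/existsP[x /andP[xA /eqP xc]]|] := boolP [exists x, (x \in A) && (ocell x == c)]; last first.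
  by rewrite negb_exists => /forallP h; rewrite eq_card0 // => y; exact: negbTE (h y).
apply: leq_trans (hN x xA); apply: subset_leq_card; apply/subsetP => y /andP[yA /eqP yc].
rewrite inE yA /=; have [r [e1 r1 r2 _]] := cellE x xA; have [r' [e2 r3 r4 _]] := cellE y yA.
have cc : cell y = cell x by rewrite -oE // -oE // xc yc.
by rewrite e1 e2 cc; lia.
Qed.

Lemma card_near_cover (T : finType) (A : {set T}) (X Y S : T -> int) (x : T)
    (U W q1 q2 q3 K N : nat) :
    (0 < q1)%N -> (0 < q2)%N -> (0 < q3)%N ->
    (U <= K * q1)%N -> (W <= K * q2)%N -> (U * W <= K * q3)%N ->
    (forall z, z \in A -> flag_near X Y S U W x z ->
      (#|[set y in A | [&& `|X y - X z| < 2 * q1%:Z, `|S y - S z| < 2 * q2%:Z &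
         `|Y y - Y z - S x * (X y - X z)| < 2 * q3%:Z]%R]| <= N)%N) ->
  (ncard (flag_near X Y S U W) A x <= (2 * K + 1) ^ 3 * N)%N.
Proof.
move=> q10 q20 q30 hU hW hUW hN.
pose V y := Y y - Y x - S x * (X y - X x).
rewrite /ncard !expnS expn0 muln1 -!mulnA.
apply: (@card_le_cells _ _ (fun y => X y - X x) q1 K) => // [y|y1].
  by rewrite inE => /andP[_ /and3P[h _ _]]; rewrite (le_trans h) ?lez_nat.
move=> y1N; apply: (@card_le_cells _ _ (fun y => S y - S x) q2 K) => // [y|y2].
  by rewrite !inE => /andP[/andP[_ /and3P[_ h _]] _]; rewrite (le_trans h) ?lez_nat.
move=> y2N; apply: (@card_le_cells _ _ V q3 K) => // [y|y3].
  by rewrite !inE => /andP[/andP[/andP[_ /and3P[_ _ h]] _] _]; rewrite (le_trans h) ?lez_nat.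
rewrite !inE => /andP[/andP[/andP[y3A y3x] h1] h2].
apply: leq_trans (hN y3 y3A y3x); apply: subset_leq_card; apply/subsetP => y.
rewrite !inE => /andP[/andP[/andP[/andP[-> _] h3] h4] h5] /=.
move: h5; rewrite /V => h5; apply/and3P; split; [by lia|by lia|].
have -> : Y y - Y y3 - S x * (X y - X y3) =
  Y y - Y x - S x * (X y - X x) - (Y y3 - Y x - S x * (X y3 - X x)) by ring.
by lia.
Qed.

(** Turning from the slope of [x] to that of [z] moves heights by up to [2 * b ^ (u + w + 2)], so
    heights are cut into cells of length [b ^ (u + w + 2)]. Positions, slopes and heights then need
    [2 * b ^ 2 + 1] cells each. *)
Lemma near_refine (T : finType) (A : {set T}) (X Y S : T -> int) (x : T)
    (b u w U' W' N : nat) :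
    (3 <= b)%N -> (2 * b ^ u <= U')%N -> (2 * b ^ w <= W')%N ->
    (4 * b ^ (u + w + 2) <= U' * W')%N ->
    (forall z, z \in A -> (ncard (flag_near X Y S U' W') A z <= N)%N) ->
  (ncard (flag_near X Y S (b ^ (u + 2)) (b ^ (w + 2))) A x <= b ^ 9 * N)%N.
Proof.
move=> b3 hU hW hUW hN; have b0 : (0 < b)%N by lia.
apply: (@leq_trans ((2 * b ^ 2 + 1) ^ 3 * N)%N); last first.
  rewrite leq_mul2r; apply/orP; right; rewrite (_ : (9 = 3 * 3)%N) // expnM leq_exp2r //.
  by rewrite !expnS expn0; have := leq_mul b3 (leqnn (b * b)); nia.
apply: (@card_near_cover _ _ _ _ _ _ _ _ (b ^ u) (b ^ w) (b ^ (u + w + 2)));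
  rewrite ?expn_gt0 ?b0 // -?expnD; try by rewrite leq_pexp2l //; lia.
move=> z zA /and3P[_ sz _]; apply: leq_trans (hN z zA).
apply: subset_leq_card; apply/subsetP => y; rewrite !inE => /andP[-> /and3P[h1 h2 h3]] /=.
apply/and3P; split; [by lia|by lia|].
have -> : flag_dist X Y S y z = `|Y y - Y z - S x * (X y - X z) - (S z - S x) * (X y - X z)|.
  by rewrite /flag_dist; congr (`| _ |); ring.
have h1' : `|X y - X z| <= (2 * b ^ u)%N%:Z by lia.
have := normz_mul_le sz h1'.
have -> : (b ^ (w + 2) * (2 * b ^ u) = 2 * b ^ (u + w + 2))%N by rewrite !expnD; lia.
move: hUW; rewrite -lez_nat; move: (U' * W')%N (b ^ (u + w + 2))%N h3 => m1 m2.
by move: (Y y - _ - _) ((S z - _) * _) => y1 y2; lia.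
Qed.

(** * Incidences produced by forks *)

Definition inc_pairs (T : finType) (X Y S : T -> int) (A : {set T}) (r : nat) : nat :=
  #|[set q in setX A A | (flag_dist X Y S q.1 q.2 <= r%:Z)%R]|.

(** The arm [j] is short in position and the arm [k] thin in slope. Their heights over the line of
    [i] contribute [U' * W] and [U * W'], and the turn of the line of [k] over the length [2 * U]
    contributes [2 * (U * W')]. *)
Lemma flag_dist_fork (T : Type) (X Y S : T -> int) (U W U' W' : nat) (i j k : T) :
    (U' <= U)%N -> flag_near X Y S U' W i j -> flag_near X Y S U W' i k ->
  flag_dist X Y S j k <= (U' * W + 3 * (U * W'))%N%:Z.
Proof.
move=> UU /and3P[x1 s1 d1] /and3P[x2 s2 d2]; rewrite /flag_dist in d1 d2 *.
have -> : Y j - Y k - S k * (X j - X k) = (Y j - Y i - S i * (X j - X i))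
  - (Y k - Y i - S i * (X k - X i)) - (S k - S i) * (X j - X k) by ring.
have x3 : `|X j - X k| <= (2 * U)%N%:Z by lia.
have := normz_mul_le s2 x3; have -> : (W' * (2 * U) = 2 * (U * W'))%N by lia.
move: (U' * W)%N (U * W')%N d1 d2 => m1 m2.
by move: (Y j - _ - _) (Y k - _ - _) ((S k - _) * _) => y1 y2 y3; lia.
Qed.

(* Given j and k, the position and slope of z are confined to a small box, and
   its height to O(b^(c+1)) cells of that box. *)
Lemma fork_multiplicity (T : finType) (XA XB : {set T}) (X Y S : T -> int)
    (b u w c n : nat) (j k : T) : (2 <= b)%N -> XB \subset XA ->
    (forall z, z \in XB -> (ncard (flag_near X Y S (b ^ u.+1) (b ^ w.+1)) XA z <= n)%N) ->
  (#|[set z in XB | flag_near X Y S (b ^ u) (b ^ (w + c.+1)) z j &&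
        flag_near X Y S (b ^ (u + c.+1)) (b ^ w) z k]| <= (4 * b ^ c.+1 + 1) * n)%N.
Proof.
move=> b2 sBA hn; have b0 : (0 < b)%N by lia.
set Z := [set z in _ | _].
pose v z := Y z + S k * (X j - X z) - Y j.
have ZP z : z \in Z -> [/\ z \in XB, `|X j - X z| <= (b ^ u)%N%:Z, `|S k - S z| <= (b ^ w)%N%:Z &
    flag_dist X Y S j z <= (b ^ u * b ^ (w + c.+1))%N%:Z].
  by rewrite inE => /andP[-> /andP[/and3P[h1 _ h2] /and3P[_ h3 _]]].
have -> : (4 * b ^ c.+1 = 2 * (2 * b ^ c.+1))%N by rewrite mulnA.
apply: (@card_le_cells _ Z v (b ^ (u + w))); first by rewrite expn_gt0 b0.
  move=> z /ZP[_ h1 h2]; rewrite /flag_dist /v => h3.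
  have -> : Y z + S k * (X j - X z) - Y j =
     (S k - S z) * (X j - X z) - (Y j - Y z - S z * (X j - X z)) by ring.
  have := normz_mul_le h2 h1.
  have -> : (2 * b ^ c.+1 * b ^ (u + w) = 2 * (b ^ u * b ^ (w + c.+1)))%N by rewrite !expnD; lia.
  have : (b ^ w * b ^ u <= b ^ u * b ^ (w + c.+1))%N by rewrite mulnC leq_mul // leq_pexp2l // leq_addr.
  move: (b ^ w * _)%N (b ^ u * _)%N h3 => m1 m2; move: (Y j - _ - _) ((S k - _) * _) => y1 y2; lia.
move=> z /ZP[zB x1 s1 _]; apply: leq_trans (hn z zB).
apply: subset_leq_card; apply/subsetP => y; rewrite 2!inE => /andP[/ZP[yB x2 s2 _]].
rewrite /v => hv; rewrite (subsetP sBA) //=.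
have hU : (2 * b ^ u <= b ^ u.+1)%N by rewrite expnS leq_mul.
have hW : (2 * b ^ w <= b ^ w.+1)%N by rewrite expnS leq_mul.
apply/and3P; split; [by lia|by lia|].
have -> : flag_dist X Y S y z = `|(Y y + S k * (X j - X y) - Y j - (Y z + S k * (X j - X z) - Y j))
   + (S k - S z) * (X y - X z)| by rewrite /flag_dist; congr (`| _ |); ring.
have x3 : `|X y - X z| <= (2 * b ^ u)%N%:Z by lia.
have := normz_mul_le s1 x3.
have -> : (b ^ w * (2 * b ^ u) = 2 * b ^ (u + w))%N by rewrite expnD; lia.
have : (4 * b ^ (u + w) <= b ^ u.+1 * b ^ w.+1)%N.
  by rewrite -expnD addSn addnS !expnS mulnA leq_mul //; apply: (@leq_trans (2 * 2)) => //; rewrite leq_mul.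
move: (_ * b ^ w.+1)%N (b ^ (u + w))%N hv => m1 m2.
by move: (_ - (Y z + _ - _)) ((S k - _) * _) => y1 y2; lia.
Qed.

(** Double counting of forks with centre [z] and arms [j], [k]: each centre has at least [n1 * n2]
    forks, and [fork_multiplicity] bounds the number of centres for a given pair of arms. *)
Lemma initial_incidences (T : finType) (XA XB : {set T}) (X Y S : T -> int)
    (b u w c n n1 n2 r : nat) (z0 : T) : (2 <= b)%N -> XB \subset XA ->
  let U := (b ^ (u + c.+1))%N in let W := (b ^ (w + c.+1))%N in
  let X1 := [set z in XB | flag_near X Y S U W z0 z] in
  let X2 := [set z in XA | flag_near X Y S (b * U) (b * W) z0 z] in
    (forall z, z \in XB -> (n1 <= ncard (flag_near X Y S (b ^ u) W) XA z)%N) ->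
    (forall z, z \in XB -> (n2 <= ncard (flag_near X Y S U (b ^ w)) XA z)%N) ->
    (forall z, z \in XB -> (ncard (flag_near X Y S (b ^ u.+1) (b ^ w.+1)) XA z <= n)%N) ->
    (4 * b ^ (u + w + c.+1) <= r)%N ->
  (#|X1| * (n1 * n2) <= inc_pairs X Y S X2 r * ((4 * b ^ c.+1 + 1) * n))%N.
Proof.
move=> b2 sBA U W X1 X2 h1 h2 h3 hr; have b0 : (0 < b)%N by lia.
pose Qs z := [set j in XA | flag_near X Y S (b ^ u) W z j].
pose Ts z := [set k in XA | flag_near X Y S U (b ^ w) z k].
pose Inc := [set q in setX X2 X2 | (flag_dist X Y S q.1 q.2 <= r%:Z)%R].
have uU : (b ^ u <= U)%N by rewrite leq_pexp2l // leq_addr.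
have wW : (b ^ w <= W)%N by rewrite leq_pexp2l // leq_addr.
have sub z : z \in X1 -> setX (Qs z) (Ts z) \subset Inc.
  rewrite inE => /andP[zB z0z]; apply/subsetP => -[j k]; rewrite in_setX !inE /=.
  move=> /andP[/andP[jA zj] /andP[kA zk]]; rewrite jA kA /=.
  rewrite (flag_near_trans b2 z0z (flag_near_weak uU (leqnn _) zj)).
  rewrite (flag_near_trans b2 z0z (flag_near_weak (leqnn _) wW zk)) /=.
  apply: (le_trans (flag_dist_fork uU zj zk)); rewrite lez_nat; apply: leq_trans hr.
  by rewrite /U /W !expnD; lia.
apply: (@leq_trans (\sum_(z in X1) #|setX (Qs z) (Ts z)|)).
  rewrite -sum_nat_const; apply: leq_sum => z zX1; rewrite cardsX leq_mul //.
    by apply: h1; move: zX1; rewrite inE => /andP[].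
  by apply: h2; move: zX1; rewrite inE => /andP[].
have -> : (\sum_(z in X1) #|setX (Qs z) (Ts z)| =
    \sum_(q in Inc) \sum_(z in X1) (q \in setX (Qs z) (Ts z)))%N.
  rewrite exchange_big /=; apply: eq_bigr => z zX1.
  rewrite -sum1_card big_mkcond [RHS]big_mkcond /=; apply: eq_bigr => q _.
  by case: (boolP (q \in setX _ _)) => hq; [rewrite (subsetP (sub z zX1))|case: ifP].
rewrite -[leqRHS]/(#|Inc| * _)%N -[leqRHS]sum_nat_const; apply: leq_sum => -[j k] _.
apply: leq_trans (@fork_multiplicity T XA XB X Y S b u w c n j k b2 sBA h3).
rewrite -sum1_card [leqLHS]big_mkcond [leqRHS]big_mkcond; apply: leq_sum => z _.
rewrite in_setX !inE; case: (z \in XB) => //=; case: (flag_near X Y S U W z0 z) => //=.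
by case: (j \in XA) => //=; case: (k \in XA); case: (flag_near _ _ _ _ _ z j).
Qed.

(** * Passing to the next finer scale *)

Ltac pow_lia :=
  clear; repeat match goal with |- context [expn ?a ?n] => generalize (expn a n) end;
  intros; lia.

(** This is [high_low] in an affine box, for two radii that differ by a factor [b]. [MP] counts
    flags in a box short in position, hence nearby points; [ML] counts flags in a box thin in slope,
    hence nearby lines. *)
Lemma inc_pairs_step (T : finType) (A : {set T}) (X Y S : T -> int) (z0 : T)
    (b b' u w x MP ML : nat) :
    b = (2 * b')%N -> (8 * x + 50 <= b)%N -> (0 < ML)%N ->
    (forall z, z \in A -> `|X z - X z0| <= (b ^ (u + x + 5))%N%:Z) ->
    (forall z, z \in A -> `|S z - S z0| <= (b ^ (w + x + 5))%N%:Z) ->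
    (#|A| <= b ^ (u + x + 6))%N ->
    (forall z, z \in A -> (ncard (flag_near X Y S (b ^ u) (b ^ (w + x + 6))) A z <= MP)%N) ->
    (forall z, z \in A -> (ncard (flag_near X Y S (b ^ (u + x + 6)) (b ^ (w + 4))) A z <= ML)%N) ->
  let I0 := inc_pairs X Y S A (b ^ (u + w + x + 8)) in
  let I1 := inc_pairs X Y S A (b ^ (u + w + x + 7)) in
  (I0 <= 8 * b * I1)%N \/ (I0 ^ 2 <= b ^ (x + 15) * #|A| ^ 2 * MP * ML)%N.
Proof.
move=> bE bx ML0 hX hS hA hMP hML I0 I1.
have b0 : (0 < b)%N by lia.
have b50 : (50 <= b)%N by lia.
have b'0 : (0 < b')%N by lia.
(* Recentring at [z0] and shearing by its slope preserves all vertical distances. *)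
pose px z := X z - X z0; pose sg z := S z - S z0.
pose pv z := Y z - Y z0 - S z0 * (X z - X z0).
have distE j k : flag_dist px pv sg j k = flag_dist X Y S j k.
  by rewrite /flag_dist /px /pv /sg; congr (`| _ |); ring.
have mulb (k m n : nat) : (k <= b)%N -> (m < n)%N -> (k * b ^ m <= b ^ n)%N.
  by move=> kb mn; apply: (@leq_trans (b ^ m.+1)); [rewrite expnS leq_mul|rewrite leq_pexp2l].
pose d := (2 * b ^ (u + w + x + 8))%N.
(* With [b] even, [2 * a] is exactly the smaller radius; [d / 2] is the larger one. *)
pose a := (b' * b ^ (u + w + x + 6))%N.
have aE : (2 * a = b ^ (u + w + x + 7))%N by rewrite /a mulnA -bE -expnS; congr expn; lia.
have [] := @high_low T A px pv sg a d (b ^ (u + x + 6)) (2 * b ^ (w + 2)) (b ^ u)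
    (b ^ (u + w + x + 4)) MP ML b (x + 4).
- rewrite aE /d; apply: leq_trans (leq_pmull _ _) => //; rewrite leq_pexp2l //; lia.
- by rewrite muln_gt0 expn_gt0 b0.
- exact: b0.
- exact: ML0.
- by rewrite expn_gt0 b0.
- by rewrite expn_gt0 b0.
- by rewrite muln_gt0 b'0 expn_gt0 b0.
- by rewrite /d mulnCA -expnD; congr (2 * b ^ _)%N; lia.
- exact: hA.
- move=> j jA; have := hX j jA.
  have : (b ^ (u + x + 5) + b ^ u <= b ^ (u + x + 6))%N.
    apply: (@leq_trans (2 * b ^ (u + x + 5))).
      by rewrite mul2n -addnn leq_add2l leq_pexp2l //; lia.
    by apply: mulb; lia.
  by rewrite /px; pow_lia.
- move=> k kA; have := hS k kA; rewrite -/(sg k) => h.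
  apply: (@le_trans _ _ ((b ^ (w + x + 5))%N%:Z * (b ^ u)%N%:Z + (b ^ (u + w + x + 4))%N%:Z)).
    by rewrite lerD2r ler_wpM2r.
  rewrite -PoszM -PoszD lez_nat -expnD.
  have -> : (w + x + 5 + u = u + w + x + 5)%N by lia.
  apply: (@leq_trans (b ^ (u + w + x + 6))); last by rewrite /a leq_pmull.
  apply: (@leq_trans (2 * b ^ (u + w + x + 5))).
    by rewrite mul2n -addnn leq_add2l leq_pexp2l //; lia.
  by apply: mulb; lia.
- move=> j jA; apply: leq_trans (hMP j jA).
  apply: subset_leq_card; apply/subsetP => y; rewrite !inE => /andP[yA /andP[h1 h2]].
  rewrite yA /=; have sj := hS j jA; have sy := hS y yA.
  have h3 : (2 * b ^ (w + x + 5) <= b ^ (w + x + 6))%N by apply: mulb; lia.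
  have xx : `|X y - X j| <= (b ^ u)%N%:Z by move: h1; rewrite /px; pow_lia.
  apply/and3P; split; [exact: xx|by move: h3 sj sy; pow_lia|].
  have -> : flag_dist X Y S y j = `|pv y - pv j - sg j * (X y - X j)|.
    by rewrite /flag_dist /pv /sg; congr (`| _ |); ring.
  have := normz_mul_le sj xx; rewrite -/(sg j) -!expnD.
  have -> : (w + x + 5 + u = u + w + x + 5)%N by lia.
  have h4 : (2 * b ^ (u + w + x + 5) <= b ^ (u + (w + x + 6)))%N by apply: mulb; lia.
  have h5 : (b ^ (u + w + x + 4) <= b ^ (u + w + x + 5))%N by rewrite leq_pexp2l //; lia.
  by move: (sg j * _) h2 h4 h5; pow_lia.
- move=> k kA; apply: leq_trans (hML k kA).
  apply: subset_leq_card; apply/subsetP => y; rewrite !inE => /andP[yA /andP[h1 h2]].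
  rewrite yA /=; have xk := hX k kA; have xy := hX y yA.
  have h3 : (2 * b ^ (u + x + 5) <= b ^ (u + x + 6))%N by apply: mulb; lia.
  have h4 : (2 * b ^ (w + 2) <= b ^ (w + 4))%N by apply: mulb; lia.
  apply/and3P; split; [by move: h3 xk xy; pow_lia|by move: h1 h4; rewrite /sg; pow_lia|].
  have -> : flag_dist X Y S y k = `|intercept px pv sg y - intercept px pv sg k
      + (sg y - sg k) * px y|.
    by rewrite /flag_dist /intercept /px /pv /sg; congr (`| _ |); ring.
  have sd : `|sg y - sg k| <= (2 * b ^ (w + 2))%N%:Z by move: h1; pow_lia.
  have := normz_mul_le sd xy; rewrite -/(px y) -mulnA -!expnD.
  have h5 : (20 * b ^ (u + w + x + 8) <= b ^ (u + x + 6 + (w + 4)))%N by apply: mulb; lia.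
  have h6 : (b ^ (w + 2 + (u + x + 5)) <= b ^ (u + w + x + 8))%N by rewrite leq_pexp2l //; lia.
  move: h2 h5 h6; rewrite /d; move: (intercept _ _ _ k) (intercept _ _ _ y) ((sg y - _) * _).
  by pow_lia.
- move=> k k1 kA k1A; have := hS k kA; have := hS k1 k1A.
  have : (2 * b ^ (w + x + 5) < b ^ (x + 4) * (2 * b ^ (w + 2)))%N.
    by rewrite mulnCA -expnD ltn_pmul2l // ltn_exp2l //; lia.
  by rewrite /sg; move: (_ * (2 * _))%N; pow_lia.
- move=> k k1 kA k1A; have := hS k kA; have := hS k1 k1A.
  have : (2 * b ^ (w + x + 5) <= d)%N.
    by rewrite /d leq_pmul2l // leq_pexp2l //; lia.
  by rewrite /sg; move: (d); pow_lia.
have -> : #|[set q in setX A A | flag_dist px pv sg q.1 q.2 <= 2 * a%:Z]| = I1.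
  rewrite /I1 /inc_pairs -aE; apply: eq_card => q; rewrite !inE distE; congr (_ && _).
have -> : #|[set q in setX A A | 2 * flag_dist px pv sg q.1 q.2 <= d%:Z]| = I0.
  rewrite /I0 /inc_pairs; apply: eq_card => q; rewrite !inE distE; congr (_ && _).
  by rewrite /d; pow_lia.
- move=> h; left; move: h; rewrite /a /d -(leq_pmul2l (isT : 0 < 2)%N).
  have -> : (2 * (b' * b ^ (u + w + x + 6) * I0) = b ^ (u + w + x + 7) * I0)%N.
    by rewrite mulnA mulnA -bE -expnS; congr (b ^ _ * _)%N; lia.
  have -> : (2 * (2 * (2 * b ^ (u + w + x + 8)) * I1) = b ^ (u + w + x + 7) * (8 * b * I1))%N.
    by rewrite (_ : u + w + x + 8 = (u + w + x + 7).+1)%N ?expnS; lia.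
  by rewrite leq_pmul2l // expn_gt0 b0.
have -> : #|[set q in setX A A | 2 * flag_dist px pv sg q.1 q.2 <= d%:Z]| = I0.
  rewrite /I0 /inc_pairs; apply: eq_card => q; rewrite !inE distE; congr (_ && _).
  by rewrite /d; pow_lia.
move=> h; right.
(* The loss from the harmonic sum is at most two powers of [b]. *)
have hbb : (10 + 8 * ((x + 4) * b) <= b ^ 2)%N.
  have hb : ((8 * x + 50) * b <= b * b)%N by rewrite leq_mul.
  by rewrite expnS expn1; move: hb b50; clear; lia.
have eL : (2 * (b ^ u * b ^ (u + w + x + 4) * a) = b ^ (3 * u + 2 * w + 2 * x + 11))%N.
  by rewrite mulnCA aE -!expnD; congr expn; lia.
have c128 : (128 <= b ^ 2)%N by apply: (@leq_trans (50 ^ 2)); rewrite ?leq_exp2r.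
rewrite -(@leq_pmul2l (b ^ (3 * u + 2 * w + 2 * x + 11))) ?expn_gt0 ?b0 // -eL.
rewrite -[leqLHS]mulnA; apply: (leq_trans (leq_mul (leqnn 2) h)); rewrite /d eL.
set N := #|A|.
apply: (@leq_trans (128 * b ^ 2 * (b ^ (u + w + x + 8)) ^ 2 * b ^ (u + x + 6) * (N ^ 2 * MP * ML))).
  have -> : (2 * (16 * N ^ 2 * MP * ML * (2 * b ^ (u + w + x + 8)) ^ 2 * b ^ (u + x + 6) *
     (10 + 8 * ((x + 4) * b))) = 128 * (10 + 8 * ((x + 4) * b)) * (b ^ (u + w + x + 8)) ^ 2 *
       b ^ (u + x + 6) * (N ^ 2 * MP * ML))%N.
    by rewrite expnMn; move: (N ^ 2)%N (b ^ (u + x + 6))%N (_ ^ 2)%N (10 + _)%N => n1 n2 n3 n4; lia.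
  by rewrite !leq_mul.
have -> : (b ^ (3 * u + 2 * w + 2 * x + 11) * (b ^ (x + 15) * N ^ 2 * MP * ML) =
  b ^ 2 * (b ^ 2 * (b ^ (u + w + x + 8)) ^ 2 * b ^ (u + x + 6)) * (N ^ 2 * MP * ML))%N.
  have -> : (b ^ (x + 15) * N ^ 2 * MP * ML = b ^ (x + 15) * (N ^ 2 * MP * ML))%N by rewrite !mulnA.
  by rewrite -expnM -!expnD mulnA -expnD; congr (b ^ _ * _)%N; lia.
by rewrite !mulnA !leq_mul.
Qed.

(** [inc_pairs] includes the diagonal, which contributes at most [#|A|] pairs. *)
Lemma inc_pairs_offdiag (T : finType) (X Y S : T -> int) (A : {set T}) (r : nat) :
    (#|A| < inc_pairs X Y S A r)%N ->
  exists j k, [/\ j \in A, k \in A, j != k & flag_dist X Y S j k <= r%:Z].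
Proof.
move=> hA; apply: contrapT => no; move: hA; apply/negP; rewrite -leqNgt.
rewrite -(card_imset (mem A) (f := fun j => (j, j))); last by move=> j k [].
apply: subset_leq_card; apply/subsetP => -[j k]; rewrite inE in_setX /= => /andP[/andP[jA kA] d].
have [<-|jk] := eqVneq j k; first by apply: imset_f.
by case: no; exists j, k.
Qed.

(** * Uniform profiles and the incidence theorem for integer flags *)

(* Upper bounds hold on XA only, and lower bounds on XB and XC for counts in the
   next larger set: exact uniformity of a single set is not available. *)
Definition uniform_profile (T : finType) (XA XB XC : {set T}) (X Y S : T -> int)
    (b A g : nat) (F : nat -> nat -> nat) : Prop :=
  [/\ XB \subset XA, XC \subset XB,
   forall i j z, (i < g)%N -> (j < g)%N -> z \in XA ->
     (ncard (flag_near X Y S (b ^ (A - i)) (b ^ (A - j))) XA z < b ^ (F i j).+1)%N,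
   forall i j z, (i < g)%N -> (j < g)%N -> z \in XB ->
     (b ^ F i j <= ncard (flag_near X Y S (b ^ (A - i)) (b ^ (A - j))) XA z)%N &
   forall i j z, (i < g)%N -> (j < g)%N -> z \in XC ->
     (b ^ F i j <= ncard (flag_near X Y S (b ^ (A - i)) (b ^ (A - j))) XB z)%N].

Lemma uniform_profile_exists (g M : nat) : exists2 C : nat, (0 < C)%N &
  forall (T : finType) (X Y S : T -> int) (b A : nat) (A0 : {set T}),
    (1 < b)%N -> A0 != set0 -> (#|A0| < b ^ M.+1)%N ->
  exists (XA XB XC : {set T}) (F : nat -> nat -> nat),
    [/\ XA \subset A0, XC != set0, (#|A0| <= C * #|XA|)%N,
        (forall i j, (g <= i)%N || (g <= j)%N -> F i j = 0%N) &
        uniform_profile XA XB XC X Y S b A g F].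
Proof.
have [C C0 hC] := uniformization (g * g) M.
exists C => // T X Y S b A A0 b1 A00 A0M.
have [||XA [XB [XC [F [[s1 s2 s3 s4] [h1 h2 h3 h4]]]]]] := hC T ('I_g * 'I_g)%type
  (fun q => flag_near X Y S (b ^ (A - q.1)) (b ^ (A - q.2))) b A0 b1 _ _ A00 A0M.
- by rewrite card_prod card_ord.
- by move=> q; apply: flag_near_refl.
(* Extended by 0 beyond the grid, the value that [uniform_profile_regular] expects there. *)
pose F' i j := if (insub i, insub j) is (Some i', Some j') then F (i', j') else 0%N.
have F'E i j (ig : (i < g)%N) (jg : (j < g)%N) : F' i j = F (Ordinal ig, Ordinal jg).
  by rewrite /F' !insubT.
exists XA, XB, XC, F'; split=> //.
  move=> i j; rewrite /F' => /orP[gi|gj]; first by rewrite insubF // ltnNge gi.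
  by case: (insub i) => // i'; rewrite insubF // ltnNge gj.
split=> // i j z ig jg zX; rewrite (F'E _ _ ig jg).
- exact: (h2 z (Ordinal ig, Ordinal jg)).
- exact: (h3 z (Ordinal ig, Ordinal jg)).
exact: (h4 z (Ordinal ig, Ordinal jg)).
Qed.

(** Nested boxes give monotonicity. Covering by [b ^ 9] smaller boxes, plus one exponent between
    lower and upper counts, gives the constant 10. For [i + j >= m] a second flag in a box would
    violate the separation. *)
Lemma uniform_profile_regular (T : finType) (XA XB XC : {set T}) (X Y S : T -> int)
    (b A g m : nat) (F : nat -> nat -> nat) :
    (4 <= b)%N -> XB != set0 -> (m < g)%N -> (g + 3 <= A)%N -> (2 * g <= 2 * A - m)%N ->
    uniform_profile XA XB XC X Y S b A g F ->
    (forall i j, (g <= i)%N || (g <= j)%N -> F i j = 0%N) ->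
    (forall j k, j \in XA -> k \in XA -> j != k ->
       ~~ (flag_dist X Y S j k <= (b ^ (2 * A - m))%N%:Z)) ->
  [/\ forall i j, (F i.+1 j <= F i j <= F i.+1 j + 10)%N,
      forall i j, (F i j.+1 <= F i j <= F i j.+1 + 10)%N &
      forall i j, (m <= i + j)%N -> F i j = 0%N].
Proof.
move=> b4 /set0Pn[z zB] mg gA g2A [sBA sCB up lo lo2] Fout sep.
have zA := subsetP sBA z zB.
have b0 : (0 < b)%N by lia.
have b1 : (1 < b)%N by lia.
have Fz i j : (m <= i + j)%N -> F i j = 0%N.
  move=> mij; have [gi|ig] := leqP g i; first by rewrite Fout ?gi.
  have [gj|jg] := leqP g j; first by rewrite Fout ?gj ?orbT.
  apply/eqP; rewrite -leqn0 -(leq_exp2l _ _ b1) expn0.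
  apply: (leq_trans (lo i j z ig jg zB)).
  rewrite -(cards1 z); apply: subset_leq_card; apply/subsetP => y.
  rewrite !inE => /andP[yA /and3P[_ _ d]]; apply: contraT => yz.
  have := sep y z yA zA yz; rewrite (le_trans d) // lez_nat -expnD leq_pexp2l //; lia.
have mono i j i' j' : (i <= i')%N -> (j <= j')%N -> (F i' j' <= F i j)%N.
  move=> ii jj; have [gi|ig] := leqP g i'; first by rewrite Fout ?gi.
  have [gj|jg] := leqP g j'; first by rewrite Fout ?gj ?orbT.
  rewrite -ltnS -(ltn_exp2l _ _ b1); apply: (leq_ltn_trans (lo _ _ z ig jg zB)).
  apply: leq_ltn_trans (up i j z _ _ zA); try lia.
  apply: subset_leq_card; apply/subsetP => y; rewrite !inE => /andP[-> h] /=.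
  by apply: flag_near_weak h; rewrite leq_pexp2l //; lia.
have lip i j i' j' : (i' < g)%N -> (j' < g)%N -> (i <= i' <= i.+1)%N -> (j <= j' <= j.+1)%N ->
    (i' + j' <= (i + j).+1)%N -> (F i j <= F i' j' + 10)%N.
  move=> ig jg ii jj ij; rewrite -(leq_exp2l _ _ b1).
  apply: (leq_trans (lo i j z _ _ zB)); try lia.
  have -> : (A - i = A - i - 2 + 2)%N by lia.
  have -> : (A - j = A - j - 2 + 2)%N by lia.
  apply: (@leq_trans (b ^ 9 * b ^ (F i' j').+1)); last by rewrite -expnD leq_pexp2l //; lia.
  have pw k s t : (k <= b)%N -> (s < t)%N -> (k * b ^ s <= b ^ t)%N.
    by move=> kb st; apply: (@leq_trans (b ^ s.+1)); [rewrite expnS leq_mul|rewrite leq_pexp2l].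
  apply: (@near_refine _ _ _ _ _ _ _ _ _ (b ^ (A - i')) (b ^ (A - j'))) => //.
  - by lia.
  - by apply: pw; lia.
  - by apply: pw; lia.
  - by rewrite -expnD; apply: pw => //; lia.
  by move=> y yA; apply: ltnW; apply: up.
split=> // i j.
- rewrite mono //=; have [gi|ig] := leqP g i.+1; first by rewrite Fz //; lia.
  have [gj|jg] := leqP g j; first by rewrite Fout ?gj ?orbT.
  by apply: lip => //; lia.
rewrite mono //=; have [gi|ig] := leqP g j.+1; first by rewrite Fz //; lia.
have [gj|jg] := leqP g i; first by rewrite Fout ?gj ?orbT.
by apply: lip => //; lia.
Qed.

Ltac nlia :=
  repeat match goal with
  | H : context [expn _ _] |- _ => clear H
  | H : context [subn _ _] |- _ => clear H
  end; lia.

(** The nested sets are used in turn: [z0] in [XC] has many neighbours in [XB], each of these is the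
    centre of many forks in [XA], and upper counts in [XA] bound the multiplicity. Forks have depth
    [c.+1]; returning to [c] costs 20. *)
Lemma uniform_profile_initial (T : finType) (XA XB XC : {set T}) (X Y S : T -> int)
    (b A g i j c : nat) (F : nat -> nat -> nat) (z0 : T) :
    (5 <= b)%N -> (0 < i)%N -> (0 < j)%N -> (g + 3 <= A)%N ->
    (i + c + 1 < g)%N -> (j + c + 1 < g)%N ->
    uniform_profile XA XB XC X Y S b A g F -> z0 \in XC ->
    (forall i j, (F i j <= F i.+1 j + 10)%N) -> (forall i j, (F i j <= F i j.+1 + 10)%N) ->
  let X2 := [set z in XA | flag_near X Y S (b ^ (A - (i - 1))) (b ^ (A - (j - 1))) z0 z] in
  is_true (b ^ (F i j + F (i + c) j + F i (j + c)) <=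
     inc_pairs X Y S X2 (b ^ (2 * A - i - j - c)) * b ^ (F (i + c) (j + c) + 24 + c))%N.
Proof.
move=> b5 i0 j0 gA ig jg [sBA sCB up lo lo2] z0C F1 F2 X2.
have b1 : (1 < b)%N by nlia.
have b0 : (0 < b)%N by nlia.
have iA : (A - i - c.+1 + c.+1 = A - i)%N by nlia.
have jA : (A - j - c.+1 + c.+1 = A - j)%N by nlia.
have := @initial_incidences T XA XB X Y S b (A - i - c.+1) (A - j - c.+1) c
  (b ^ (F (i + c) (j + c)).+1)%N (b ^ F (i + c.+1) j)%N (b ^ F i (j + c.+1))%N
  (b ^ (2 * A - i - j - c)) z0 (ltnW (ltnW (ltnW b5))) sBA.
rewrite /= iA jA -!expnS.
have -> : ((A - i).+1 = A - (i - 1))%N by nlia.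
have -> : ((A - j).+1 = A - (j - 1))%N by nlia.
have -> : ((A - i - c.+1).+1 = A - (i + c))%N by nlia.
have -> : ((A - j - c.+1).+1 = A - (j + c))%N by nlia.
have -> : (A - i - c.+1 = A - (i + c.+1))%N by nlia.
have -> : (A - j - c.+1 = A - (j + c.+1))%N by nlia.
rewrite -/X2 => h.
have {}h : (b ^ F i j * (b ^ F (i + c.+1) j * b ^ F i (j + c.+1)) <=
  inc_pairs X Y S X2 (b ^ (2 * A - i - j - c)) * ((4 * b ^ c.+1 + 1) * b ^ (F (i + c) (j + c)).+1))%N.
  apply: leq_trans (h _ _ _ _).
  - by rewrite leq_mul //; apply: lo2 => //; nlia.
  - by move=> z zB; apply: lo => //; nlia.
  - by move=> z zB; apply: lo => //; nlia.
  - by move=> z zB; apply: ltnW; apply: up; rewrite ?(subsetP sBA) //; nlia.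
  apply: (@leq_trans (b ^ (2 * A - i - j - c - 1).+1)); last by rewrite leq_pexp2l //; nlia.
  by rewrite expnS leq_mul //; [nlia|rewrite leq_pexp2l //; nlia].
have e1 : (F i j + F (i + c) j + F i (j + c) <= F i j + (F (i + c.+1) j + F i (j + c.+1)) + 20)%N.
  by have := F1 (i + c)%N j; have := F2 i (j + c)%N; rewrite !addnS; nlia.
apply: (@leq_trans (b ^ (F i j + (F (i + c.+1) j + F i (j + c.+1)) + 20))%N).
  by rewrite leq_pexp2l.
rewrite expnD !(expnD b (F i j)) (expnD b (F (i + c.+1)%N j)).
apply: (leq_trans (leq_mul h (leqnn _))); rewrite -[leqLHS]mulnA leq_mul //.
have h4 : (4 * b ^ c.+1 + 1 <= b ^ c.+2)%N.
  rewrite (expnS b c.+1); have : (0 < b ^ c.+1)%N by rewrite expn_gt0 b0.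
  have : (5 * b ^ c.+1 <= b * b ^ c.+1)%N by rewrite leq_mul.
  by nlia.
apply: (@leq_trans (b ^ c.+2 * b ^ (F (i + c) (j + c)).+1 * b ^ 20)%N); first by rewrite !leq_mul.
by rewrite -!expnD leq_pexp2l //; nlia.
Qed.

(** Incidences at depth [c] are carried down one power of [b] at a time, because the other
    alternative of [inc_pairs_step] contradicts the inequality for [F] at that depth. At depth
    [c + l] they outnumber the flags of the box. *)
Lemma uniform_profile_chain (T : finType) (XA XB XC : {set T}) (X Y S : T -> int)
    (b b' A g i j c l : nat) (F : nat -> nat -> nat) (z0 : T) :
    b = (2 * b')%N -> (8 * g + 50 <= b)%N -> (8 ^ g <= b)%N ->
    (2 < i)%N -> (2 < j)%N -> (2 * g + 10 <= A)%N -> (0 < c)%N ->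
    (i + c + l + 4 < g)%N -> (j + c + l + 4 < g)%N ->
    (#|XA| <= b ^ (A - g))%N ->
    uniform_profile XA XB XC X Y S b A g F -> z0 \in XC ->
    (forall i j, (F i.+1 j <= F i j <= F i.+1 j + 10)%N) ->
    (forall i j, (F i j.+1 <= F i j <= F i j.+1 + 10)%N) ->
    (forall x, (c <= x)%N -> (x <= c + l)%N ->
      (F (i + x) j + F i (j + x) + 3 * x + 2 * F (i + c) (j + c) + 150
         <= 2 * F (i + c) j + 2 * F i (j + c))%N) ->
  exists j1 j2, [/\ j1 \in XA, j2 \in XA, j1 != j2 &
    flag_dist X Y S j1 j2 <= (b ^ (2 * A - i - j - (c + l)))%N%:Z].
Proof.
move=> bE b50 b8 i2 j2 gA c0 ig jg XAle prof z0C F1 F2 win.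
have [sBA sCB up lo lo2] := prof.
have b1 : (1 < b)%N by nlia.
have b0 : (0 < b)%N by nlia.
have F1' i' j' : (F i' j' <= F i'.+1 j' + 10)%N by case/andP: (F1 i' j').
have F2' i' j' : (F i' j' <= F i' j'.+1 + 10)%N by case/andP: (F2 i' j').
have F1m i' j' n : (F (i' + n) j' <= F i' j')%N.
  elim: n => [|n IHn]; first by rewrite addn0.
  by rewrite addnS; case/andP: (F1 (i' + n)%N j') => h _; apply: leq_trans IHn.
have z0A : z0 \in XA by rewrite (subsetP sBA) // (subsetP sCB).
set X2 := [set z in XA | flag_near X Y S (b ^ (A - (i - 1))) (b ^ (A - (j - 1))) z0 z].
have sX2 : X2 \subset XA by apply/subsetP => z; rewrite inE => /andP[].
have X2le : (#|X2| <= b ^ (F i j + 21))%N.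
  apply: ltnW; apply: (leq_trans (up _ _ _ _ _ z0A)); try nlia.
  rewrite leq_pexp2l //; have := F1' (i - 1)%N (j - 1)%N; have := F2' i (j - 1)%N.
  by rewrite !subn1 !prednK; nlia.
set f0 := F i j; set f1 := F (i + c)%N j; set f2 := F i (j + c)%N; set f12 := F (i + c)%N (j + c)%N.
pose I x := inc_pairs X Y S X2 (b ^ (2 * A - i - j - x)).
(* Each step loses [8 * b]: the [b] enters the exponent [c + n], and the factors 8 are collected, at
   most [b] in all. *)
have key n : (n <= l)%N -> (b ^ (f0 + f1 + f2) <= I (c + n) * b ^ (f12 + 24 + (c + n)) * 8 ^ n)%N.
  elim: n => [_|n IHn nl].
    rewrite addn0 expn0 muln1.
    by apply: (@uniform_profile_initial _ XA XB XC _ _ _ _ _ g) => //; nlia.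
  have {}IHn := IHn (ltnW nl); set x := (c + n)%N in IHn *.
  have uE : (A - i - x - 4 + x + 5 = A - (i - 1))%N by nlia.
  have wE : (A - j - x - 4 + x + 5 = A - (j - 1))%N by nlia.
  have uE6 : (A - i - x - 4 + x + 6 = A - (i - 2))%N by nlia.
  have wE6 : (A - j - x - 4 + x + 6 = A - (j - 2))%N by nlia.
  have wE4 : (A - j - x - 4 + 4 = A - (j + x))%N by nlia.
  have uE4 : (A - i - x - 4 = A - (i + x + 4))%N by nlia.
  have [||||||||] := @inc_pairs_step T X2 X Y S z0 b b' (A - i - x - 4) (A - j - x - 4) x
     (b ^ (F (i + x + 4) (j - 2)).+1)%N (b ^ (F (i - 2) (j + x)).+1)%N bE.
  - by nlia.
  - by rewrite expn_gt0 b0.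
  - by move=> z; rewrite inE => /andP[_ /and3P[h _ _]]; rewrite uE.
  - by move=> z; rewrite inE => /andP[_ /and3P[_ h _]]; rewrite wE.
  - apply: (leq_trans (subset_leq_card sX2)); apply: (leq_trans XAle).
    by rewrite leq_pexp2l //; nlia.
  - move=> z zX2; rewrite uE4 wE6; apply: ltnW; apply: leq_ltn_trans (ncard_sub _ _ sX2) _.
    by apply: up; rewrite ?(subsetP sX2) //; nlia.
  - move=> z zX2; rewrite uE6 wE4; apply: ltnW; apply: leq_ltn_trans (ncard_sub _ _ sX2) _.
    by apply: up; rewrite ?(subsetP sX2) //; nlia.
  - have -> : (A - i - x - 4 + (A - j - x - 4) + x + 8 = 2 * A - i - j - x)%N by nlia.
    have -> : (A - i - x - 4 + (A - j - x - 4) + x + 7 = 2 * A - i - j - (c + n.+1))%N by nlia.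
    rewrite -/(I x) -/(I (c + n.+1)%N) => h; apply: (leq_trans IHn).
    apply: (@leq_trans (8 * b * I (c + n.+1) * b ^ (f12 + 24 + x) * 8 ^ n)%N); first by rewrite !leq_mul.
    have -> : (f12 + 24 + (c + n.+1) = (f12 + 24 + x).+1)%N by rewrite /x; nlia.
    by rewrite !expnS; move: (b ^ _)%N (8 ^ n)%N (I _) => p1 p2 p3; clear; lia.
  have -> : (A - i - x - 4 + (A - j - x - 4) + x + 8 = 2 * A - i - j - x)%N by nlia.
  rewrite -/(I x) => h; exfalso.
  have h8 : (8 ^ n <= b)%N by apply: leq_trans b8; rewrite leq_pexp2l //; nlia.
  have IHn2 : (b ^ (f0 + f1 + f2) <= I x * b ^ (f12 + 25 + x))%N.
    apply: (leq_trans IHn); rewrite -mulnA leq_mul //.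
    have -> : (f12 + 25 + x = (f12 + 24 + x).+1)%N by nlia.
    by rewrite expnS mulnC leq_mul.
  have w := win x _ _; rewrite -/f1 -/f2 -/f12 in w.
  have h1 : ((b ^ (f0 + f1 + f2)) ^ 2 <= b ^ (x + 15) * (b ^ (f0 + 21)) ^ 2 *
     b ^ (F (i + x) j + 21) * b ^ (F i (j + x) + 21) * (b ^ (f12 + 25 + x)) ^ 2)%N.
    apply: (@leq_trans ((I x * b ^ (f12 + 25 + x)) ^ 2)); first by rewrite leq_exp2r.
    rewrite expnMn leq_mul //; apply: (leq_trans h); rewrite !leq_mul //.
    - rewrite leq_pexp2l //; have := F1m (i + x)%N (j - 2)%N 4%N.
      have := F2' (i + x)%N (j - 2)%N; have := F2' (i + x)%N (j - 1)%N.
      have -> : ((j - 2).+1 = j - 1)%N by nlia.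
      have -> : ((j - 1).+1 = j)%N by nlia.
      by nlia.
    - rewrite leq_pexp2l //.
    have := F1' (i - 2)%N (j + x)%N; have := F1' (i - 1)%N (j + x)%N.
    have -> : ((i - 2).+1 = i - 1)%N by nlia.
    have -> : ((i - 1).+1 = i)%N by nlia.
    by nlia.
  (* The additive constants sum to 149, one below the 150 of the hypothesis. *)
  move: h1; rewrite -!expnM -!expnD leq_exp2l // => h1.
  have := w _ _; have cx : (c <= x)%N by rewrite /x leq_addr.
  have xl : (x <= c + l)%N by rewrite /x leq_add2l ltnW.
  by move=> /(_ cx xl); nlia.
have keyl := key l (leqnn l).
have h8 : (8 ^ l <= b)%N by apply: leq_trans b8; rewrite leq_pexp2l //; nlia.
have [|j1 [j2' [h1 h2 h3 h4]]] := @inc_pairs_offdiag T X Y S X2 (b ^ (2 * A - i - j - (c + l))); last first.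
  by exists j1, j2'; split=> //; apply: (subsetP sX2).
(* At most [b ^ (f0 + 21)] incidences would be too few, by the hypothesis at [c + l]. *)
rewrite ltnNge; apply/negP => small.
have : (b ^ (f0 + f1 + f2) <= b ^ (f0 + 21) * b ^ (f12 + 24 + (c + l)) * b)%N.
  apply: (leq_trans keyl); rewrite !leq_mul // (leq_trans _ X2le) //.
rewrite -expnD mulnC -expnS leq_exp2l // => h.
have := win (c + l)%N (leq_addr _ _) (leqnn _); rewrite -/f1 -/f2 -/f12.
by move: h; clear; lia.
Qed.

(** Without an incidence the profile satisfies [scale_selection], with Lipschitz constant 10 and
    slack 150. The chain from the selected depth down to the last one then produces an incidence.
    [b0] depends on [m], since it absorbs the pigeonhole loss and [8 ^ g]. *)
Lemma flag_incidence (E : nat) : (0 < E)%N ->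
  exists m0 : nat, forall m : nat, (m0 <= m)%N -> exists b0 : nat,
  forall (T : finType) (X Y S : T -> int) (b b' A s : nat) (A0 : {set T}),
    b = (2 * b')%N -> (b0 <= b)%N -> (10 * m + 100 <= A)%N ->
    (forall j k, j \in A0 -> k \in A0 -> flag_near X Y S (b ^ (A - 3)) (b ^ (A - 3)) j k) ->
    (0 < s)%N -> (b ^ s <= #|A0|)%N -> (#|A0| < b ^ (3 * m).+1)%N ->
    ((3 * E + 3) * m <= 2 * E * (s - 1))%N ->
  exists j k, [/\ j \in A0, k \in A0, j != k &
    flag_dist X Y S j k <= (b ^ (2 * A - (m + 6)))%N%:Z].
Proof.
move=> E0; have [m0 hm0] := @scale_selection E 10 150 E0 isT.
exists m0 => m mm0; set g := (2 * m + 20)%N.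
have [C C0 hC] := uniform_profile_exists g (3 * m).
exists (C + 8 * g + 50 + 8 ^ g)%N => T X Y S b b' A s A0 bE bb hA near s0 hs hM hE.
have b1 : (1 < b)%N by move: bb; pow_lia.
have b0 : (0 < b)%N by apply: ltnW.
have A00 : A0 != set0 by rewrite -card_gt0; apply: leq_trans hs; rewrite expn_gt0 b0.
have [XA [XB [XC [F [sXA XC0 hXA Fout prof]]]]] := hC T X Y S b A A0 b1 A00 hM.
have [sBA sCB up lo lo2] := prof.
apply: contrapT => nopair.
have sep j k : j \in XA -> k \in XA -> j != k ->
    ~~ (flag_dist X Y S j k <= (b ^ (2 * A - (m + 6)))%N%:Z).
  move=> jA kA jk; apply/negP => d; apply: nopair; exists j, k.
  by rewrite !(subsetP sXA).
have [z0 z0C] := set0Pn _ XC0; have z0B := subsetP sCB _ z0C.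
have XB0 : XB != set0 by apply/set0Pn; exists z0.
have b4 : (4 <= b)%N by move: bb; pow_lia.
have mg : (m + 6 < g)%N by rewrite /g; clear; lia.
have gA : (g + 3 <= A)%N by move: hA; rewrite /g; clear; lia.
have g2A : (2 * g <= 2 * A - (m + 6))%N by move: hA; rewrite /g; clear; lia.
have [F1 F2 Fz] := uniform_profile_regular b4 XB0 mg gA g2A prof Fout sep.
have z0A := subsetP sBA _ z0B.
(* The box [(3, 3)] around [z0] contains all of [XA]; the loss [C <= b] costs one exponent. *)
have F33 : (s - 1 <= F 3 3)%N.
  rewrite -ltnS -(ltn_exp2l _ _ b1); apply: leq_ltn_trans (up 3%N 3%N z0 _ _ z0A); try by rewrite /g; clear; lia.
  rewrite -(@leq_pmul2l C) //; apply: (@leq_trans (b ^ s)).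
    rewrite -{2}(prednK s0) expnS subn1 leq_mul //.
    by move: bb; pow_lia.
  apply: (leq_trans hs); apply: (leq_trans hXA); rewrite leq_mul //.
  apply: subset_leq_card; apply/subsetP => y yA; rewrite inE yA /=.
  by apply: near; apply: (subsetP sXA).
(* The shift by 3 makes room for the larger boxes at [i - 1] and [i - 2], and accounts for
   [m + 6]. *)
pose F' i j := F (i + 3)%N (j + 3)%N.
have [||||i [j [c [ijc win]]]] := hm0 m F' mm0.
- by move=> i j; apply: F1.
- by move=> i j; apply: F2.
- by move=> i j mij; apply: Fz; move: mij; clear; lia.
- by apply: (leq_trans hE); rewrite leq_mul.
have c0 : (0 < c)%N.
  rewrite lt0n; apply/eqP => c0; move: ijc (win 0%N); rewrite c0 !addn0; clear; lia.
have XAle : (#|XA| <= b ^ (A - g))%N.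
  apply: (leq_trans (subset_leq_card sXA)); apply: (leq_trans (ltnW hM)).
  by rewrite leq_pexp2l //; move: hA; rewrite /g; clear; lia.
have h1 : (8 * g + 50 <= b)%N by move: bb; pow_lia.
have h2 : (8 ^ g <= b)%N by move: bb; pow_lia.
have h3 : (2 * g + 10 <= A)%N by move: hA; rewrite /g; clear; lia.
have h4 : (i + 3 + c + (m - i - j - c) + 4 < g)%N by move: ijc; rewrite /g; clear; lia.
have h5 : (j + 3 + c + (m - i - j - c) + 4 < g)%N by move: ijc; rewrite /g; clear; lia.
have h6 k : (2 < k + 3)%N by rewrite addn3.
have [|j1 [j2 [j1A j2A j12 d]]] := uniform_profile_chain (l := m - i - j - c) bE h1 h2 (h6 i) (h6 j) h3 c0
   h4 h5 XAle prof z0C F1 F2.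
- move=> x cx xl; have := win x cx; rewrite /F'.
  have -> : (i + 3 + x = i + x + 3)%N by rewrite addnAC.
  have -> : (j + 3 + x = j + x + 3)%N by rewrite addnAC.
  have -> : (i + 3 + c = i + c + 3)%N by rewrite addnAC.
  have -> : (j + 3 + c = j + c + 3)%N by rewrite addnAC.
  by apply; move: ijc xl; clear; lia.
apply/negP: (sep _ _ j1A j2A j12).
have -> : (2 * A - (m + 6) = 2 * A - (i + 3) - (j + 3) - (c + (m - i - j - c)))%N.
  by move: ijc hA; clear; lia.
by rewrite d.
Qed.

From mathcomp Require Import all_classical all_reals all_analysis.
Import numFieldNormedType.Exports.

Local Open Scope classical_set_scope.
Local Open Scope ring_scope.

(** * Rounding real flags *)

Lemma floor_frac (R : realType) (x : R) : exists2 f : R, x = (Num.floor x)%:~R + f & 0 <= f < 1.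
Proof.
exists (x - (Num.floor x)%:~R); first by rewrite addrC subrK.
have /andP[h1 h2] := floor_itv x; rewrite intrD in h2.
by rewrite subr_ge0 h1 ltrBlDl.
Qed.

Lemma floor_bound (R : realType) (x : R) (n : nat) : 0 <= x <= n%:R -> 0 <= Num.floor x <= n%:Z.
Proof.
move=> /andP[x0 xn]; rewrite floor_ge0 x0 -(@ler_int R); apply: le_trans (floor_le _) _.
by rewrite -pmulrn.
Qed.

Lemma floor_bound_norm (R : realType) (x : R) (n : nat) : `|x| <= n%:R -> `|Num.floor x| <= n%:Z.
Proof.
rewrite !ler_norml => /andP[x0 xn]; rewrite floor_ge_int -(@ler_int R) mulrNz -pmulrn x0 /=.
exact: le_trans (floor_le _) _.
Qed.

(** Positions and slopes are scaled by [N] and heights by [N ^ 2], so that slope times position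
    scales like height. *)
Lemma rounding_near (R : realType) (T : Type) (x y s : T -> R) (N U : nat) (j k : T) :
    (3 * N <= U)%N ->
    (forall i, 0 <= x i <= 1) -> (forall i, 0 <= y i <= 1) -> (forall i, `|s i| <= 1) ->
  flag_near (fun i => Num.floor (x i * N%:R)) (fun i => Num.floor (y i * (N ^ 2)%:R))
    (fun i => Num.floor (s i * N%:R)) U U j k.
Proof.
move=> NU hx hy hs.
have X i : 0 <= Num.floor (x i * N%:R) <= N%:Z.
  by apply: floor_bound; have /andP[h1 h2] := hx i; rewrite mulr_ge0 ?ler0n //= ler_piMl ?ler0n.
have Y i : 0 <= Num.floor (y i * (N ^ 2)%:R) <= (N ^ 2)%N%:Z.
  by apply: floor_bound; have /andP[h1 h2] := hy i; rewrite mulr_ge0 ?ler0n //= ler_piMl ?ler0n.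
have S i : `|Num.floor (s i * N%:R)| <= N%:Z.
  apply: floor_bound_norm; rewrite normrM [`|N%:R|]ger0_norm ?ler0n //.
  by rewrite ler_piMl ?ler0n.
have := X j; have := X k; have := Y j; have := Y k; have := S j; have := S k.
rewrite /flag_near /flag_dist.
move: (Num.floor (x j * _)) (Num.floor (x k * _)) (Num.floor (y j * _)) (Num.floor (y k * _)).
move: (Num.floor (s j * _)) (Num.floor (s k * _)) => S1 S2 X1 X2 Y1 Y2 s1 s2 y1 y2 x1 x2.
have dx : `|X2 - X1| <= N%:Z by lia.
have dd := normz_mul_le s2 dx.
have hUU : (3 * N ^ 2 <= U * U)%N.
  by rewrite expnS expn1; have := leq_mul NU NU; lia.
apply/and3P; split; [by lia|by lia|]; move: (S1 * _) dd => q dd.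
by move: dd y1 y2 hUU; rewrite expnS expn1; lia.
Qed.

(** Rounding the heights costs at most 1; rounding the positions and rounding the slope cost at most
    [N] each. *)
Lemma rounding_dist (R : realType) (T : Type) (x y s : T -> R) (N : nat) (j k : T) : (0 < N)%N ->
    (forall i, 0 <= x i <= 1) -> `|s k| <= 1 ->
  `|y j - y k - s k * (x j - x k)| * (N ^ 2)%:R <=
  (flag_dist (fun i => Num.floor (x i * N%:R)) (fun i => Num.floor (y i * (N ^ 2)%:R))
    (fun i => Num.floor (s i * N%:R)) j k)%:~R + 3 * N%:R.
Proof.
move=> N0 hx hs; rewrite /flag_dist.
have N1 : 1 <= N%:R :> R by rewrite ler1n.
have [f1 e1 /andP[f10 f11]] := floor_frac (x j * N%:R).
have [f2 e2 /andP[f20 f21]] := floor_frac (x k * N%:R).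
have [g1 h1 /andP[g10 g11]] := floor_frac (y j * (N ^ 2)%:R).
have [g2 h2 /andP[g20 g21]] := floor_frac (y k * (N ^ 2)%:R).
have [r r1 /andP[r10 r11]] := floor_frac (s k * N%:R).
have Sk : `|(Num.floor (s k * N%:R))%:~R : R| <= N%:R.
  rewrite -intr_norm [leRHS]pmulrn ler_int; apply: floor_bound_norm.
  by rewrite normrM [`|N%:R|]ger0_norm ?ler0n // ler_piMl ?ler0n.
have dx : `|x j - x k| <= 1.
  by have := hx j; have := hx k; move=> /andP[? ?] /andP[? ?]; rewrite ler_norml; lra.
rewrite -[X in _ * X]ger0_norm ?ler0n // -normrM.
move: e1 e2 h1 h2 r1 Sk.
move: (Num.floor (x j * _)) (Num.floor (x k * _)) (Num.floor (y j * _)) (Num.floor (y k * _)).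
move: (Num.floor (s k * _)) => S X1 X2 Y1 Y2 e1 e2 h1 h2 r1 Sk.
have -> : (y j - y k - s k * (x j - x k)) * (N ^ 2)%:R =
   (Y1 - Y2 - S * (X1 - X2))%:~R + (g1 - g2) - S%:~R * (f1 - f2) - r * (N%:R * (x j - x k)).
  have -> : (y j - y k - s k * (x j - x k)) * (N ^ 2)%:R =
    y j * (N ^ 2)%:R - y k * (N ^ 2)%:R - (s k * N%:R) * (x j * N%:R - x k * N%:R).
    by rewrite natrX; ring.
  have -> : N%:R * (x j - x k) = x j * N%:R - x k * N%:R by ring.
  by rewrite h1 h2 r1 e1 e2 !(intrM, intrB, intrD); ring.
rewrite intr_norm.
apply: (le_trans (ler_normB _ _)); apply: (@le_trans _ _ (`|(Y1 - Y2 - S * (X1 - X2))%:~R| + 1 + N%:R + N%:R)).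
  apply: lerD.
    apply: (le_trans (ler_normB _ _)); apply: lerD.
      apply: (le_trans (ler_normD _ _)); rewrite lerD2l ler_norml; lra.
    by rewrite normrM -[leRHS]mulr1 ler_pM // ler_norml; lra.
  rewrite !normrM -[leRHS]mul1r -[leRHS]mulr1 [`|N%:R|]ger0_norm ?ler0n // -mulrA.
  by rewrite ler_pM ?mulr_ge0 ?ler0n ?normr_ge0 // ?ler_norml; first lra; rewrite ler_pM ?ler0n.
by rewrite -!addrA lerD2l; lra.
Qed.

(** With [N = b ^ (A - 4)], the integer distance [b ^ (2 * A - (m + 6))] plus the rounding error
    [3 * N] stays below [N ^ 2 / b ^ (m - 3)]. *)
Lemma real_flag_incidence (E : nat) : (0 < E)%N ->
  exists m0 : nat, forall m : nat, (m0 <= m)%N -> (3 <= m)%N -> exists b0 : nat,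
  forall (R : realType) (T : finType) (x y s : T -> R) (b b' e : nat) (A0 : {set T}),
    b = (2 * b')%N -> (b0 <= b)%N ->
    (forall i, 0 <= x i <= 1) -> (forall i, 0 <= y i <= 1) -> (forall i, `|s i| <= 1) ->
    (0 < e <= 3 * m)%N -> (b ^ e <= #|A0|)%N -> ((3 * E + 3) * m <= 2 * E * (e - 1))%N ->
  exists j k, [/\ j \in A0, k \in A0, j != k &
    `|y j - y k - s k * (x j - x k)| * (b ^ (m - 3))%:R < 1].
Proof.
move=> E0; have [m0 hm0] := flag_incidence E0; exists m0 => m mm0 m3.
have [b0 hb0] := hm0 m mm0; exists (b0 + 3)%N => R T x y s b b' e A0 bE bb hx hy hs.
move=> /andP[e0 em] hA hE; pose A := (10 * m + 100)%N.
have b3 : (3 <= b)%N by move: bb; clear; lia.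
have bpos : (0 < b)%N by exact: leq_trans b3.
have b1 : (1 < b)%N by exact: leq_trans b3.
(* Exactly [b ^ e] flags are kept, to meet the upper bound on their number. *)
have [B sBA cB] := subset_of_size hA.
pose N := (b ^ (A - 4))%N.
have N0 : (0 < N)%N by rewrite expn_gt0 bpos.
have NU : (3 * N <= b ^ (A - 3))%N.
  have -> : (A - 3 = (A - 4).+1)%N by rewrite /A; clear; lia.
  by rewrite expnS leq_mul.
pose X i := Num.floor (x i * N%:R); pose Y i := Num.floor (y i * (N ^ 2)%:R).
pose S i := Num.floor (s i * N%:R).
have [|||||j [k [jB kB jk d]]] := hb0 T X Y S b b' A e B bE _ _ _ e0 _ _ hE.
- by apply: leq_trans bb; rewrite leq_addr.
- exact: leqnn.
- by move=> j k _ _; apply: rounding_near.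
- by rewrite cB.
- by rewrite cB ltn_exp2l // ltnS.
exists j, k; split=> //; try exact: (fintype.subsetP sBA).
have := rounding_dist (T := T) (x := x) y (s := s) j (k := k) N0 hx (hs k).
rewrite -/X -/Y -/S => h.
have N2 : (b ^ (m - 3) * b ^ (2 * A - m - 5) = N ^ 2)%N.
  by rewrite /N -expnM -expnD; congr expn; move: m3; rewrite /A; clear; lia.
have p0 : 0 < (b ^ (2 * A - m - 5))%N%:R :> R by rewrite ltr0n expn_gt0 bpos.
rewrite -(ltr_pM2r p0) -mulrA -natrM N2 mul1r.
apply: (le_lt_trans h).
apply: (@le_lt_trans _ _ ((b ^ (2 * A - (m + 6)))%N%:R + 3 * N%:R)).
  by rewrite lerD2r [leRHS]pmulrn ler_int.
rewrite -natrM -natrD ltr_nat.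
have -> : (2 * A - m - 5 = (2 * A - (m + 6)).+1)%N by move: m3; rewrite /A; clear; lia.
have h2 : (3 * N <= b ^ (2 * A - (m + 6)))%N.
  by apply: (leq_trans NU); rewrite leq_pexp2l //; move: m3; rewrite /A; clear; lia.
have h3 : (0 < b ^ (2 * A - (m + 6)))%N by rewrite expn_gt0 bpos.
rewrite expnS; have := leq_mul b3 (leqnn (b ^ (2 * A - (m + 6)))); move: h2 h3.
by move: (3 * N)%N; pow_lia.
Qed.

(** * Choice of the parameters *)

Lemma powR_natX (R : realType) (a r : R) (n : nat) : (a `^ r) ^+ n = a `^ (r * n%:R).
Proof. by rewrite powRrM powR_mulrn // powR_ge0. Qed.

(** [m] is fixed by [eps], and [b] is of the order of [delta ^ (-1 / (m - 3))], so small [delta]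
    means large [b]. Half of [eps] absorbs the constant factors. The factor 2 in the hypothesis
    allows for a split of the lines into two slope classes. *)
Lemma real_flags_near (R : realType) (eps : R) : 0 < eps ->
  exists2 delta0 : R, 0 < delta0 & forall delta : R, 0 < delta < delta0 ->
  forall (T : finType) (x y s : T -> R) (A0 : {set T}),
    (forall i, 0 <= x i <= 1) -> (forall i, 0 <= y i <= 1) -> (forall i, `|s i| <= 1) ->
    delta `^ (- (3 / 2) - eps) <= 2 * #|A0|%:R ->
  exists j k, [/\ j \in A0, k \in A0, j != k & `|y j - y k - s k * (x j - x k)| < delta].
Proof.
move=> eps0; pose E := (Num.truncn (12 / eps)).+2.
have E12 : 12 <= eps * E%:R.
  rewrite mulrC -ler_pdivrMr // ltW // (lt_le_trans (truncnS_gt _)) // ler_nat; exact: leqnSn.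
have [m0 hm0] := @real_flag_incidence E isT.
pose q := (m0 + (Num.truncn eps).+2)%N.
have q2 : (2 <= q)%N by rewrite /q; clear; lia.
have qeps : eps + 1 <= q%:R.
  have h := truncnS_gt eps; apply: (@le_trans _ _ (Num.truncn eps).+2%:R).
    by rewrite -[X in X%:R]addn1 natrD lerD2r ltW.
  by rewrite ler_nat /q leq_addl.
(* These values give [(3 * E + 3) * m = 2 * E * (e - 1)], and [E >= 12 / eps] keeps [e / k] below
   [3 / 2 + eps / 2]. *)
pose m := (2 * E * q)%N; pose k := (m - 3)%N; pose e := (1 + (3 * E + 3) * q)%N.
have E2 : (2 <= E)%N by [].
have m3 : (3 < m)%N.
  by have := leq_mul (leq_mul (leqnn 2) E2) q2; rewrite -/m; apply: leq_trans.
have mm0 : (m0 <= m)%N.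
  by apply: (@leq_trans q); [rewrite /q leq_addr|rewrite /m leq_pmull // muln_gt0].
have [b0 hb0] := hm0 m mm0 (ltnW m3).
have k0 : (0 < k)%N by rewrite /k subn_gt0.
have k0R : 0 < k%:R :> R by rewrite ltr0n.
have kE : k%:R = 2 * E%:R * q%:R - 3 :> R.
  by rewrite /k natrB ?(ltnW m3) // !natrM.
have eE : e%:R = 1 + (3 * E%:R + 3) * q%:R :> R by rewrite /e natrD natrM natrD natrM.
have ek : e%:R / k%:R <= 3 / 2 + eps / 2.
  rewrite ler_pdivrMr // kE eE.
  have : 12 * q%:R <= eps * E%:R * q%:R by rewrite ler_wpM2r ?ler0n.
  by move: qeps; move: (q%:R : R) (E%:R : R) => Q F; nra.
(* The 2 comes from the hypothesis on [#|A0|], the power of 4 from [b <= 4 * t]. *)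
pose c : R := 2 * 4 ^+ e.
have c0 : 0 < c by rewrite mulr_gt0 // exprn_gt0.
exists (Num.min 1 (Num.min ((b0.+1%:R : R) ^- k) (c `^ (- (2 / eps))))).
  by rewrite !lt_min ltr01 invr_gt0 exprn_gt0 ?ltr0n // powR_gt0.
move=> delta /andP[d0]; rewrite !lt_min => /andP[d1 /andP[db dc]] T x y s A0 hx hy hs hA.
pose t := delta `^ (- (1 / k%:R)).
have tk : t ^+ k = delta^-1.
  by rewrite /t powR_natX mulNr div1r mulVf ?gt_eqF // powR_inv1 // ltW.
have te : t ^+ e <= delta `^ (- (3 / 2) - eps / 2).
  rewrite /t powR_natX; apply: ger_powR; first by rewrite d0 ltW.
  by rewrite mulNr div1r mulrC; lra.
have tpos : 0 <= t by apply: powR_ge0.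
have tb : b0.+1%:R <= t.
  rewrite -(@ler_pXn2r _ k) ?nnegrE ?ler0n // tk.
  by rewrite -[leLHS]invrK lef_pV2 ?posrE ?invr_gt0 ?exprn_gt0 ?ltr0n // ltW.
have t1 : 1 <= t by apply: le_trans tb; rewrite ler1n.
pose b' := (Num.truncn t).+1; pose b := (2 * b')%N.
have tb' : t < b'%:R by apply: truncnS_gt.
have b't : b'%:R <= t + 1.
  by rewrite /b' -addn1 natrD lerD2r truncn_le.
have b4 : b%:R <= 4 * t by rewrite /b natrM; lra.
have bb0 : (b0 <= b)%N.
  have h : (b0.+1 < b')%N by rewrite -(@ltr_nat R) (le_lt_trans tb).
  by rewrite /b; move: h; clear; lia.
have cd : c <= delta `^ (- (eps / 2)).
  rewrite powRN -[c]invrK lef_pV2 ?posrE ?invr_gt0 ?powR_gt0 //.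
  have h : delta `^ (eps / 2) <= (c `^ (- (2 / eps))) `^ (eps / 2).
    by apply: ge0_ler_powR; rewrite ?nnegrE ?powR_ge0 ?divr_ge0 // ltW.
  apply: (le_trans h); rewrite -powRrM.
  have -> : - (2 / eps) * (eps / 2) = -1 by field; rewrite gt_eqF.
  by rewrite powR_inv1 // ltW.
have be : (b ^ e <= #|A0|)%N.
  rewrite -(@ler_nat R) -(@ler_pM2l _ 2) //; apply: le_trans hA.
  rewrite natrX; apply: (@le_trans _ _ (2 * (4 * t) ^+ e)).
    by rewrite ler_pM2l // lerXn2r ?nnegrE ?ler0n // mulr_ge0.
  rewrite exprMn mulrA -/c.
  have -> : - (3 / 2) - eps = - (eps / 2) + (- (3 / 2) - eps / 2) by field.
  rewrite powRD; last by apply/implyP => _; rewrite gt_eqF.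
  by rewrite ler_pM // ?exprn_ge0 // ltW.
have he : (0 < e <= 3 * m)%N.
  apply/andP; split=> //; rewrite /e /m.
  by have := leq_mul E2 (leqnn q); move: q2; clear; move: E => F; lia.
have hE : ((3 * E + 3) * m <= 2 * E * (e - 1))%N.
  by rewrite /e /m addKn; clear; move: E => F; lia.
have [j [l [jA lA jl d]]] := hb0 R T x y s b b' e A0 erefl bb0 hx hy hs he be hE.
exists j, l; split=> //.
have bk : delta^-1 <= (b ^ (m - 3))%N%:R.
  rewrite -tk natrX lerXn2r ?nnegrE ?ler0n //; apply: (le_trans (ltW tb')).
  by rewrite ler_nat /b leq_pmull.
rewrite -[ltRHS]mul1r -ltr_pdivrMr //.
by apply: le_lt_trans d; rewrite ler_wpM2l.
Qed.

(** * From tubes to flags *)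

Lemma tube_through_direction (R : realType) (delta : R) (T : set 'rV[R]_2) (p : 'rV[R]_2) :
  tube_through delta T p -> exists2 v : 'rV[R]_2, v != 0 &
    forall (t : R) (q : 'rV[R]_2), euclidean_dist q (p + t *: v) < delta -> T q.
Proof.
move=> [L [[a [v [v0 ->]]] ->]] [t0 _ <-]; exists v => // t q d.
by exists (a + t0 *: v + t *: v) => //; exists (t0 + t) => //; rewrite scalerDl addrA.
Qed.

(** Over the coordinate [a] the line of [k] is a graph of slope at most 1, and the distance along
    [b] bounds the Euclidean distance to the line. *)
Lemma tubes_near (R : realType) (n : nat) (delta : R) (p v : 'I_n -> 'rV[R]_2)
    (T : 'I_n -> set 'rV[R]_2) (a b : 'I_2) (A : {set 'I_n}) :
    (forall i : 'I_2, i = a \/ i = b) -> a != b ->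
    (forall k, k \in A -> v k 0 a != 0 /\ `|v k 0 b| <= `|v k 0 a|) ->
    (forall k t q, euclidean_dist q (p k + t *: v k) < delta -> T k q) ->
    (forall (x y s : 'I_n -> R), (forall i, x i = p i 0 a) -> (forall i, y i = p i 0 b) ->
      (forall i, `|s i| <= 1) ->
      exists j k, [/\ j \in A, k \in A, j != k & `|y j - y k - s k * (x j - x k)| < delta]) ->
  exists j k : 'I_n, j != k /\ T k (p j).
Proof.
move=> iab ab vA hT near.
(* The slope is 0 outside [A], where [v k 0 a] may vanish, so that it is bounded by 1 for every
   index. *)
pose s k := if k \in A then v k 0 b / v k 0 a else 0.
have [//|//||j [k [jA kA jk d]]] := near (fun i => p i 0 a) (fun i => p i 0 b) s.
  move=> i; rewrite /s; case: ifP => [iA|_]; last by rewrite normr0.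
  by have [va0 vba] := vA i iA; rewrite normf_div ler_pdivrMr ?normr_gt0 // mul1r.
exists j, k; split=> //; have [va0 _] := vA k kA.
(* The parameter of the point on the line of [k] with the same [a]-coordinate as [p j]. *)
apply: (hT k ((p j 0 a - p k 0 a) / v k 0 a)).
rewrite /euclidean_dist (bigD1 b) //= big1 ?addr0 => [|i ib]; last first.
  have [->|ib'] := iab i; last by rewrite ib' eqxx in ib.
  by rewrite !mxE divfK // addrC subrK subrr expr0n.
rewrite !mxE sqrtr_sqr; apply: le_lt_trans d; rewrite /s kA.
have -> : p j 0 b - (p k 0 b + (p j 0 a - p k 0 a) / v k 0 a * v k 0 b) =
  p j 0 b - p k 0 b - v k 0 b / v k 0 a * (p j 0 a - p k 0 a) by ring.
exact: lexx.
Qed.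

Unset Implicit Arguments.
Set Strict Implicit.
Set Printing Implicit Defensive.

Theorem theorem1p1 (R : realType) (eps : R) (heps : 0 < eps) :
  exists2 delta0 : R, 0 < delta0 &
    forall delta : R, 0 < delta < delta0 ->
    forall (n : nat) (p : 'I_n -> 'rV[R]_2) (T : 'I_n -> set 'rV[R]_2),
      (forall j, unit_square (p j)) ->
      (forall j, is_tube delta (T j) /\ tube_through delta (T j) (p j)) ->
      delta `^ (- (3 / 2) - eps) <= n%:R ->
      exists j k : 'I_n, j != k /\ T k (p j).
Proof.
have [delta0 d0 near] := real_flags_near heps.
exists delta0 => // delta hd n p T hp hT hn.
have /boolp.choice[v hv] : forall j, exists v : 'rV[R]_2, v != 0 /\
    forall t q, euclidean_dist q (p j + t *: v) < delta -> T j q.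
  by move=> j; have [v v0 h] := tube_through_direction (proj2 (hT j)); exists v.
have hT' k t q : euclidean_dist q (p k + t *: v k) < delta -> T k q by apply: (hv k).2.
(* Lines at most 45 degrees from the first axis. Exchanging the coordinates brings the others into
   this position, and one of the two classes contains at least half of the tubes. *)
pose A := [set j : 'I_n | `|v j 0 1| <= `|v j 0 0|]%SET.
have step (a b : 'I_2) (A0 : {set 'I_n}) : (forall i : 'I_2, i = a \/ i = b) -> a != b ->
    (forall k, k \in A0 -> `|v k 0 b| <= `|v k 0 a|) -> (n <= 2 * #|A0|)%N ->
    exists j k : 'I_n, j != k /\ T k (p j).
  move=> iab ab vA0 nA0; apply: (tubes_near (v := v) (delta := delta) (A := A0) iab ab) => //.
    move=> k /vA0 vba; split=> //; apply: contra (hv k).1 => /eqP va0.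
    apply/eqP/rowP => i; rewrite mxE; have [->//|->] := iab i.
    by apply/eqP; rewrite -normr_le0 (le_trans vba) // va0 normr0.
  move=> x y s hx hy hs; apply: (near delta hd _ x y s A0) => //.
  - by move=> i; rewrite hx; exact: hp.
  - by move=> i; rewrite hy; exact: hp.
  by apply: (le_trans hn); rewrite -natrM ler_nat.
have i01 (i : 'I_2) : i = 0 \/ i = 1.
  by case: i => -[|[|//]] h; [left|right]; apply: val_inj.
have [big|small] := leqP n (2 * #|A|).
  by apply: (step 0 1 A) => // k; rewrite inE.
apply: (step 1 0 (~: A)%SET) => //.
- by move=> i; have [] := i01 i; [right|left].
- by move=> k; rewrite !inE -ltNge => /ltW.
have e := cardsC A; rewrite card_ord in e.
by rewrite -{1}e mul2n -addnn leq_add2r -(leq_add2l #|A|) e addnn -mul2n ltnW.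
Qed.
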